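(* Let $\mu\in(0,1)$, let $p_1<p_2$ be real numbers, and let $u_0$ be a tempered distribution on $\mathbb{R}$ satisfying Condition $(C_{[p_1,p_2],\mu})$, with $\mathcal{F}u_0(p)=(p-p_1)^{\mu-1}\tilde u(p)$ on $(p_1,p_2)$. Let $u$ be the solution of the free Schrödinger equation with initial datum $u_0$. Fix $\varepsilon\in(0,\frac12)$. For $t>(p_2-p_1)^{-1/\varepsilon}$ and $x=2p_1t+2t^{1-\varepsilon}$ define $$H(t,u_0):=\frac1{2\sqrt\pi}e^{-i\frac\pi4}e^{it(p_1+t^{-\varepsilon})^2}\,\tilde u(p_1+t^{-\varepsilon}),\qquad K_\mu(t,u_0):=\frac{\Gamma(\mu)}{2^{\mu+1}\pi}e^{i\frac{\pi\mu}2}e^{-itp_1^2+ixp_1}\,\tilde u(p_1).$$ Let $\delta\in(\frac12,1)$ satisfy $\delta>\frac12+\varepsilon$ and $\delta>\mu$, put $\gamma:=2\delta-1$, and let the exponents $\tilde\alpha_k^{(i)},\tilde\beta_k^{(i)}$ be those listed in the context. Then there exist constants $C_k^{(i)}(u_0)\ge0$, depending only on $u_0$ and $\delta$, such that for all $(t,x)$ with $t>(p_2-p_1)^{-1/\varepsilon}$ and $\frac xt=2p_1+2t^{-\varepsilon}$: (1) if $\mu>\frac12$, $$\left|u(t,x)-H(t,u_0)\,t^{-\frac12+\varepsilon(1-\mu)}\right|\le\sum_{k=1}^9C_k^{(1)}(u_0)\,t^{-\tilde\beta_k^{(1)}+\varepsilon\tilde\alpha_k^{(1)}},$$ where $\max_{1\le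 k\le9}\{-\tilde\beta_k^{(1)}+\varepsilon\tilde\alpha_k^{(1)}\}<-\frac12+\varepsilon(1-\mu)$; (2) if $\mu=\frac12$, $$\left|u(t,x)-\big(K_\mu(t,u_0)+H(t,u_0)\big)t^{-\frac12+\frac\varepsilon2}\right|\le\sum_{k=1}^8C_k^{(2)}(u_0)\,t^{-\tilde\beta_k^{(2)}+\varepsilon\tilde\alpha_k^{(2)}},$$ where $\max_{1\le k\le8}\{-\tilde\beta_k^{(2)}+\varepsilon\tilde\alpha_k^{(2)}\}<-\frac12+\frac\varepsilon2$; (3) if $\mu<\frac12$, $$\left|u(t,x)-K_\mu(t,u_0)\,t^{-\mu+\varepsilon\mu}\right|\le\sum_{k=1}^9C_k^{(3)}(u_0)\,t^{-\tilde\beta_k^{(3)}+\varepsilon\tilde\alpha_k^{(3)}},$$ where $\max_{1\le k\le9}\{-\tilde\beta_k^{(3)}+\varepsilon\tilde\alpha_k^{(3)}\}<-\mu+\varepsilon\mu$.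
   Context: Fourier transform: $\mathcal{F}v(p)=\int_{\mathbb{R}}v(x)e^{-ixp}\,dx$, extended to tempered distributions. Condition $(C_{[p_1,p_2],\mu})$: $\mathcal{F}u_0$ is a function vanishing on $\mathbb{R}\setminus[p_1,p_2]$, and $\mathcal{F}u_0(p)=(p-p_1)^{\mu-1}\tilde u(p)$ for $p\in(p_1,p_2)$, where $\tilde u\in\mathcal{C}^1([p_1,p_2],\mathbb{C})$, $\tilde u(p_1)\ne0$ and $\tilde u(p_2)=0$ (i.e. $\mathcal{F}u_0(p_2)=0$). The solution of $[i\partial_t+\partial_x^2]u=0$, $u(0)=u_0$, is $u(t)=\mathcal{F}^{-1}(e^{-itp^2}\mathcal{F}u_0)$, that is, for $t>0$, $x\in\mathbb{R}$, $$u(t,x)=\frac1{2\pi}\int_{p_1}^{p_2}\mathcal{F}u_0(p)\,e^{-itp^2+ixp}\,dp .$$ Exponents: $(\tilde\alpha_k^{(1)})_{k=1}^9=(\mu,\,2-\mu,\,1-\mu,\,4-\mu,\,1+\gamma-\mu,\,\gamma-\mu,\,3-\mu,\,2-\mu,\,1-\mu)$, $(\tilde\beta_k^{(1)})_{k=1}^9=(\mu,1,1,2,\delta,\delta,\frac32,\delta,\delta)$; $(\tilde\alpha_k^{(2)})_{k=1}^8=(2-\mu,\,1-\mu,\,4-\mu,\,1+\gamma-\mu,\,\gamma-\mu,\,3-\mu,\,2-\mu,\,1-\mu)$, $(\tilde\beta_k^{(2)})_{k=1}^8=(1,1,2,\delta,\delta,\frac32,\delta,\delta)$; $(\tilde\alpha_k^{(3)})_{k=1}^9=(1-\mu,\,2-\mu,\,1-\mu,\,4-\mu,\,1+\gamma-\mu,\,\gamma-\mu,\,3-\mu,\,2-\mu,\,1-\mu)$,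 $(\tilde\beta_k^{(3)})_{k=1}^9=(\frac12,1,1,2,\delta,\delta,\frac32,\delta,\delta)$. *)

(* Defs.v *)
From Stdlib Require Export Reals List RList.
From Coquelicot Require Export Coquelicot.
Export ListNotations.
Open Scope R_scope.

Definition Cexpi (theta : R) : C := (cos theta, sin theta).

Definition Gamma (z : R) : R :=
  RInt_gen (fun s => Rpower s (z - 1) * exp (- s))
    (at_right 0) (Rbar_locally p_infty).

Definition CDerive_n (phi : R -> C) (n : nat) (x : R) : C :=
  (Derive_n (fun y => Re (phi y)) n x, Derive_n (fun y => Im (phi y)) n x).

Definition smooth (phi : R -> C) : Prop :=
  forall n x, ex_derive_n (fun y => Re (phi y)) n x /\
              ex_derive_n (fun y => Im (phi y)) n x.

Definition schwartz_bound (phi : R -> C) (k n : nat) (M : R) : Prop :=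
  forall x, Rabs x ^ k * Cmod (CDerive_n phi n x) <= M.

Definition schwartz (phi : R -> C) : Prop :=
  smooth phi /\ forall k n, exists M, schwartz_bound phi k n M.

Definition schwartz_cvg (phi_ : nat -> R -> C) (phi : R -> C) : Prop :=
  forall k n e, 0 < e ->
    exists N, forall j, (N <= j)%nat ->
      schwartz_bound (fun x => (phi_ j x - phi x)%C) k n e.

(** [T] is a map on all functions [R -> C], but only its values on Schwartz
    functions are meaningful. *)
Definition tempered (T : (R -> C) -> C) : Prop :=
  (forall (a b : C) (phi psi : R -> C), schwartz phi -> schwartz psi ->
     T (fun x => (a * phi x + b * psi x)%C) = (a * T phi + b * T psi)%C) /\
  (forall (phi_ : nat -> R -> C) (phi : R -> C),
     (forall j, schwartz (phi_ j)) -> schwartz phi -> schwartz_cvg phi_ phi ->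
     filterlim (fun j => T (phi_ j)) eventually (locally (T phi))).

Definition fourier (v : R -> C) (p : R) : C :=
  RInt_gen (V := C_R_CompleteNormedModule)
    (fun x => (v x * Cexpi (- (x * p)))%C)
    (Rbar_locally m_infty) (Rbar_locally p_infty).

Definition fourier_distr (T : (R -> C) -> C) : (R -> C) -> C :=
  fun phi => T (fourier phi).

(** The distribution [T] is the function [f], which vanishes outside [[a, b]]
    and may be singular at [a] and [b]: the pairing of [f] with a test function
    is an improper integral over [(a, b)]. *)
Definition is_function_on (T : (R -> C) -> C) (f : R -> C) (a b : R) : Prop :=
  (forall p, ~ (a <= p <= b) -> f p = RtoC 0) /\
  (forall phi, schwartz phi ->
     is_RInt_gen (V := C_R_NormedModule) (fun p => (f p * phi p)%C)
       (at_right a) (at_left b) (T phi)).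

(** [C^1] on the closed interval, with one-sided derivatives at the ends. *)
Definition C1_on (f : R -> C) (a b : R) : Prop :=
  exists df : R -> C, forall p, a <= p <= b ->
    filterlim (fun q => ((f q - f p) / RtoC (q - p))%C)
      (within (fun q => a <= q <= b) (locally' p)) (locally (df p)) /\
    filterlim df (within (fun q => a <= q <= b) (locally p)) (locally (df p)).

(** [Fu0] is the function [F u_0] and [ut] is the regular factor [u~]. *)
Definition condition_C (p1 p2 mu : R) (u0 : (R -> C) -> C) (Fu0 ut : R -> C)
    : Prop :=
  is_function_on (fourier_distr u0) Fu0 p1 p2 /\
  (forall p, p1 < p < p2 -> Fu0 p = (RtoC (Rpower (p - p1) (mu - 1)) * ut p)%C) /\
  C1_on ut p1 p2 /\ ut p1 <> RtoC 0 /\ ut p2 = RtoC 0.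

Definition schrodinger_sol (p1 p2 : R) (Fu0 : R -> C) (t x : R) : C :=
  (RtoC (1 / (2 * PI)) *
   RInt_gen (V := C_R_CompleteNormedModule)
     (fun p => (Fu0 p * Cexpi (- (t * p ^ 2) + x * p))%C)
     (at_right p1) (at_left p2))%C.

Definition Hcoef (p1 : R) (ut : R -> C) (eps t : R) : C :=
  (RtoC (1 / (2 * sqrt PI)) * Cexpi (- (PI / 4)) *
   Cexpi (t * (p1 + Rpower t (- eps)) ^ 2) * ut (p1 + Rpower t (- eps))%R)%C.

Definition Kcoef (p1 mu : R) (ut : R -> C) (t x : R) : C :=
  (RtoC (Gamma mu / (Rpower 2 (mu + 1) * PI)) * Cexpi (PI * mu / 2) *
   Cexpi (- (t * p1 ^ 2) + x * p1) * ut p1)%C.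

(** [k] runs from 1; [nth] counts from 0, whence [k - 1]. *)

Definition alpha1 (mu gamma : R) (k : nat) : R :=
  nth (k - 1) [mu; 2 - mu; 1 - mu; 4 - mu; 1 + gamma - mu; gamma - mu;
               3 - mu; 2 - mu; 1 - mu] 0.
Definition beta1 (mu delta : R) (k : nat) : R :=
  nth (k - 1) [mu; 1; 1; 2; delta; delta; 3 / 2; delta; delta] 0.

Definition alpha2 (mu gamma : R) (k : nat) : R :=
  nth (k - 1) [2 - mu; 1 - mu; 4 - mu; 1 + gamma - mu; gamma - mu;
               3 - mu; 2 - mu; 1 - mu] 0.
Definition beta2 (delta : R) (k : nat) : R :=
  nth (k - 1) [1; 1; 2; delta; delta; 3 / 2; delta; delta] 0.

Definition alpha3 (mu gamma : R) (k : nat) : R :=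
  nth (k - 1) [1 - mu; 2 - mu; 1 - mu; 4 - mu; 1 + gamma - mu; gamma - mu;
               3 - mu; 2 - mu; 1 - mu] 0.
Definition beta3 (delta : R) (k : nat) : R :=
  nth (k - 1) [1 / 2; 1; 1; 2; delta; delta; 3 / 2; delta; delta] 0.

Definition expo (alpha beta : nat -> R) (eps : R) (k : nat) : R :=
  - beta k + eps * alpha k.

Definition error_sum (n : nat) (Ck : nat -> R) (alpha beta : nat -> R)
    (eps t : R) : R :=
  sum_n_m (fun k => Ck k * Rpower t (expo alpha beta eps k)) 1 n.

Definition max_expo (n : nat) (alpha beta : nat -> R) (eps : R) : R :=
  MaxRlist (map (expo alpha beta eps) (seq 1 n)).

Definition on_curve (p1 p2 eps t x : R) : Prop :=
  Rpower (p2 - p1) (- (1 / eps)) < t /\ x / t = 2 * p1 + 2 * Rpower t (- eps).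

(* Main.v *)
(** Put [s = t^(-eps)], [v(q) = ut (p1 + q)]. Up to a unimodular factor,
    [2 pi u(t, x)] is [int_0^L q^(mu-1) v(q) e^(-i t (q-s)^2) dq] with
    [L = p2 - p1]. The integral is cut at [s/2].

    On [[0, s/2]] the phase has no stationary point. With [w = q - q^2/(2s)] it
    becomes linear, and the model amplitude [v(0) w^(mu-1) dw/dq] produces the
    incomplete Gamma integral whose limit is the [K_mu] term. The remaining
    amplitude vanishes one order better at [0], so one integration by parts gives
    [O(t^-1 s^(mu-2))].

    On [[s/2, L]] the amplitude [f = q^(mu-1) v] is [C^1] with
    [f' = O(s^(mu-2))] and [f(L) = 0]. Integrating by parts against the Fresnel
    remainder, which is [O(min(t^(-1/2), 1/(t|q-s|)))], hence
    [O(t^-delta |q-s|^(1-2delta))], leaves [sqrt(pi/t) e^(-i pi/4) f(s)], the [H]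
    term, up to [O(t^-delta s^(mu-2))].

    Both the oscillating Gamma integral and the Fresnel integral come from
    [int y^(mu-1) e^(-y) dy] by turning the contour by a quarter.

    Everything is done for the real integrals with kernel
    [cos (t (q-s)^2 + th)]; the phase [th] and [th + PI/2] recover the real and
    imaginary parts. For [t < 1] the constraint [s < L] makes all terms
    [O(t^-delta s^(mu-1))]. *)

Require Import Defs.
From Stdlib Require Import Reals List RList Lra Lia.
From Coquelicot Require Import Coquelicot.
Open Scope R_scope.

(** * Real powers and integral estimates *)

(* Coquelicot states equalities of integrals at carriers that are merely
   convertible to [R], on which [ring] and [field] fail. *)
Ltac as_R := match goal with |- @eq _ ?a ?b => change (@eq R a b) end.

(** The exponent [eps] enters only through [s = t^(-eps)], and every estimate is uniform in [t], [s]
    and the phase; hence constants that depend on the datum and on [delta] but not on [eps]. The cut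
    at [s/2] keeps a distance [s/2] both from the singularity at [0] and from the stationary point
    at [s], so each derivative of the amplitude costs one factor [1/s]. The parameter [delta]
    appears because [1/(t|q-s|)] is not integrable at [q = s], while [t^(-1/2)] alone gains nothing
    over the leading term; the interpolated bound is integrable and still decays faster than
    [t^(-1/2)]. The zero of the amplitude at [p2] keeps the estimate uniform: a boundary term there
    would carry [1/(t(L-s))], unbounded as the stationary point approaches [p2]. The error
    [t^(-delta) s^(mu-2)] has exponent [-delta + eps(2-mu)], and the small times give
    [-delta + eps(1-mu)]; these are the last two entries of each list. Both leading terms are kept
    for all [mu]; the three cases differ only in which of them is absorbed into the error. *)

Lemma Rpower_pos (x a : R) : 0 < Rpower x a.
Proof. apply exp_pos. Qed.

Lemma Rpower_base_1 (a : R) : Rpower 1 a = 1.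
Proof. unfold Rpower. rewrite ln_1, Rmult_0_r. apply exp_0. Qed.

Lemma Rpower_le_antitone (x y a : R) :
  0 < x <= y -> a <= 0 -> Rpower y a <= Rpower x a.
Proof.
  intros Hxy Ha.
  replace a with (- (- a)) by ring.
  rewrite (Rpower_Ropp y), (Rpower_Ropp x).
  apply Rinv_le_contravar; [apply Rpower_pos | apply Rle_Rpower_l; lra].
Qed.

Lemma Rpower_le_one (x a : R) : 0 < x <= 1 -> 0 <= a -> Rpower x a <= 1.
Proof.
  intros Hx Ha. rewrite <- (Rpower_base_1 a). apply Rle_Rpower_l; lra.
Qed.

Lemma Rpower_le_exponent (x a b : R) :
  0 < x <= 1 -> a <= b -> Rpower x b <= Rpower x a.
Proof.
  intros Hx Hab. replace b with (a + (b - a)) by ring. rewrite Rpower_plus.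
  pose proof (Rpower_pos x a). pose proof (Rpower_le_one x (b - a) Hx).
  nra.
Qed.

Lemma Rpower_minus_one (x a : R) : 0 < x -> Rpower x (a - 1) = Rpower x a / x.
Proof.
  intros Hx. unfold Rminus. rewrite Rpower_plus, Rpower_Ropp, Rpower_1 by lra.
  reflexivity.
Qed.

Lemma is_derive_Rpower (a x : R) :
  0 < x -> is_derive (fun y => Rpower y a) x (a * Rpower x (a - 1)).
Proof. intros Hx. apply is_derive_Reals, derivable_pt_lim_power, Hx. Qed.

Lemma Derive_Rpower (a x : R) :
  0 < x -> Derive (fun y => Rpower y a) x = a * Rpower x (a - 1).
Proof. intros Hx. apply is_derive_unique, is_derive_Rpower, Hx. Qed.

Lemma ex_derive_Rpower (a x : R) : 0 < x -> ex_derive (fun y => Rpower y a) x.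
Proof. intros Hx. eexists. apply is_derive_Rpower, Hx. Qed.

Lemma continuous_Rpower (a x : R) : 0 < x -> continuous (fun y => Rpower y a) x.
Proof.
  intros Hx.
  apply (ex_derive_continuous (V := R_NormedModule)), ex_derive_Rpower, Hx.
Qed.

(** This sends a cut-off [a] to [0] inside an estimate, with no limit of integrals to be taken. The
    sign of [K] is arbitrary. *)
Lemma le_of_le_power (x y K mu d : R) :
  0 < mu -> 0 < d -> (forall a, 0 < a < d -> x <= y + K * Rpower a mu) ->
  x <= y.
Proof.
  intros Hmu Hd H. apply Rnot_lt_le. intros Hxy.
  (* If [x] exceeded [y], an [a] with [a^mu <= e] would make the error at most half of the excess
     [x - y]. *)
  set (e := (x - y) / (2 * (Rabs K + 1))).
  assert (HK := Rabs_pos K).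
  assert (He : 0 < e) by (apply Rdiv_lt_0_compat; lra).
  set (a := Rmin (d / 2) (Rpower e (/ mu))).
  assert (Ha : 0 < a < d).
  { unfold a. split.
    - apply Rmin_glb_lt; [lra | apply Rpower_pos].
    - apply Rle_lt_trans with (d / 2); [apply Rmin_l | lra]. }
  specialize (H a Ha).
  assert (Hp : Rpower a mu <= e).
  { apply Rle_trans with (Rpower (Rpower e (/ mu)) mu).
    - apply Rle_Rpower_l; [lra | split; [lra | apply Rmin_r]].
    - rewrite Rpower_mult, Rinv_l, Rpower_1 by lra. lra. }
  assert (K * Rpower a mu <= (Rabs K + 1) * e).
  { pose proof (Rle_abs K). pose proof (Rpower_pos a mu). nra. }
  replace ((Rabs K + 1) * e) with ((x - y) / 2) in H0
    by (unfold e; field; lra).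
  lra.
Qed.

Lemma RInt_abs_le_primitive (f g G : R -> R) (a b : R) :
  a <= b ->
  ex_RInt f a b ->
  (forall x, a <= x <= b -> is_derive G x (g x)) ->
  (forall x, a <= x <= b -> continuous g x) ->
  (forall x, a <= x <= b -> Rabs (f x) <= g x) ->
  Rabs (RInt f a b) <= G b - G a.
Proof.
  intros Hab Hf HG Hg Hfg.
  apply (norm_RInt_le (V := R_NormedModule) f g a b).
  - exact Hab.
  - exact Hfg.
  - apply (RInt_correct (V := R_CompleteNormedModule)), Hf.
  - apply (is_RInt_derive (V := R_CompleteNormedModule) G g);
      rewrite Rmin_left, Rmax_right by lra; auto.
Qed.

(** Both [G - f] and [G + f] have nonnegative derivative. The mean value theorem then suffices, and
    neither [df] nor [dG] has to be integrable. *)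
Lemma abs_increment_le (f df G dG : R -> R) (a b : R) :
  a <= b ->
  (forall x, a <= x <= b -> is_derive f x (df x)) ->
  (forall x, a <= x <= b -> is_derive G x (dG x)) ->
  (forall x, a <= x <= b -> Rabs (df x) <= dG x) ->
  Rabs (f b - f a) <= G b - G a.
Proof.
  intros Hab Hf HG H.
  assert (K : forall s, s = 1 \/ s = -1 -> s * (f b - f a) <= G b - G a).
  { intros s Hs.
    assert (D : forall x, a <= x <= b ->
              is_derive (fun x => G x - s * f x) x (dG x - s * df x)).
    { intros x Hx. apply (is_derive_minus (V := R_NormedModule)).
      - apply HG, Hx.
      - apply (is_derive_scal f x s (df x)), Hf, Hx. }
    destruct (MVT_gen (fun x => G x - s * f x) a b (fun x => dG x - s * df x))
      as [c [Hc He]]; rewrite ?Rmin_left, ?Rmax_right in * by lra.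
    - intros x Hx. apply D; lra.
    - intros x Hx. apply continuity_pt_filterlim.
      apply (ex_derive_continuous (V := R_NormedModule)
               (fun x => G x - s * f x)).
      eexists. apply D, Hx.
    - specialize (H c Hc). pose proof (Rle_abs (df c)).
      pose proof (Rle_abs (- df c)). rewrite Rabs_Ropp in *.
      assert (0 <= dG c - s * df c) by (destruct Hs; subst; lra).
      nra. }
  apply Rabs_le. pose proof (K 1 (or_introl eq_refl)).
  pose proof (K (-1) (or_intror eq_refl)). lra.
Qed.

Lemma RInt_split (f : R -> R) (a b c : R) :
  ex_RInt f a b -> ex_RInt f b c -> RInt f a c = RInt f a b + RInt f b c.
Proof.
  intros H1 H2. symmetry.
  apply (RInt_Chasles (V := R_CompleteNormedModule)); assumption.
Qed.

Lemma RInt_by_parts (f df g dg : R -> R) (a b : R) :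
  a <= b ->
  (forall x, a <= x <= b -> is_derive f x (df x)) ->
  (forall x, a <= x <= b -> is_derive g x (dg x)) ->
  (forall x, a <= x <= b -> continuous df x) ->
  (forall x, a <= x <= b -> continuous dg x) ->
  RInt (fun x => f x * dg x) a b
  = f b * g b - f a * g a - RInt (fun x => df x * g x) a b.
Proof.
  intros Hab Hf Hg Hdf Hdg.
  assert (cf : forall x, a <= x <= b -> continuous f x).
  { intros x Hx. apply (ex_derive_continuous (V := R_NormedModule)).
    eexists; apply Hf, Hx. }
  assert (cg : forall x, a <= x <= b -> continuous g x).
  { intros x Hx. apply (ex_derive_continuous (V := R_NormedModule)).
    eexists; apply Hg, Hx. }
  assert (H := is_RInt_scal_derive (V := R_CompleteNormedModule)
                 f g df dg a b).
  rewrite Rmin_left, Rmax_right in H by lra.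
  specialize (H Hf Hg Hdf Hdg).
  apply is_RInt_unique in H.
  assert (E1 : ex_RInt (fun x => df x * g x) a b).
  { apply (ex_RInt_continuous (V := R_CompleteNormedModule)).
    rewrite Rmin_left, Rmax_right by lra. intros x Hx.
    apply (continuous_mult df g); auto. }
  assert (E2 : ex_RInt (fun x => f x * dg x) a b).
  { apply (ex_RInt_continuous (V := R_CompleteNormedModule)).
    rewrite Rmin_left, Rmax_right by lra. intros x Hx.
    apply (continuous_mult f dg); auto. }
  assert (S := RInt_plus (V := R_CompleteNormedModule) _ _ a b E1 E2).
  change (RInt (fun x => df x * g x + f x * dg x) a b
          = RInt (fun x => df x * g x) a b + RInt (fun x => f x * dg x) a b)
    in S.
  change (RInt (fun x => df x * g x + f x * dg x) a b
          = f b * g b - f a * g a) in H.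
  lra.
Qed.

(** * Rotation of the Gamma integral *)

(* Real part of [e^(i th) (e^(i phi))^mu y^(mu-1) exp (-y e^(i phi))]. *)
Definition rotated_gamma (mu th phi y : R) : R :=
  Rpower y (mu - 1) * (exp (- (y * cos phi)) * cos (mu * phi + th - y * sin phi)).

Definition rotated_gamma_dphi (mu th phi y : R) : R :=
  Rpower y (mu - 1) *
  (exp (- (y * cos phi)) *
   (y * sin phi * cos (mu * phi + th - y * sin phi)
    - (mu - y * cos phi) * sin (mu * phi + th - y * sin phi))).

(** Real part of [i e^(i th) z^mu e^(-z)] at [z = y e^(i phi)]. Its radial derivative equals the
    angular derivative of [rotated_gamma], which is the holomorphy of [z^(mu-1) e^(-z)] in real
    form. *)
Definition rotated_gamma_flux (mu th phi y : R) : R :=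
  - (Rpower y mu * (exp (- (y * cos phi)) * sin (mu * phi + th - y * sin phi))).

Lemma is_derive_rotated_gamma (mu th phi y : R) :
  is_derive (fun p => rotated_gamma mu th p y) phi
    (rotated_gamma_dphi mu th phi y).
Proof.
  unfold rotated_gamma, rotated_gamma_dphi. auto_derive; [trivial | unfold Rminus; ring].
Qed.

Lemma is_derive_rotated_gamma_flux (mu th phi y : R) :
  0 < y ->
  is_derive (rotated_gamma_flux mu th phi) y (rotated_gamma_dphi mu th phi y).
Proof.
  intros Hy. unfold rotated_gamma_flux.
  auto_derive; [apply ex_derive_Rpower, Hy | ].
  rewrite Derive_Rpower by exact Hy.
  unfold rotated_gamma_dphi.
  replace (Rpower y mu) with (y * Rpower y (mu - 1))
    by (rewrite Rpower_minus_one by lra; field; lra).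
  unfold Rminus. ring.
Qed.

Ltac continuity_2d :=
  repeat match goal with
  | |- continuity_2d_pt (fun _ _ => ?c) _ _ => apply continuity_2d_pt_const
  | |- continuity_2d_pt (fun u _ => u) _ _ => apply continuity_2d_pt_id1
  | |- continuity_2d_pt (fun _ v => v) _ _ => apply continuity_2d_pt_id2
  | |- continuity_2d_pt (fun u v => @?f u v * @?g u v) _ _ =>
      apply (continuity_2d_pt_mult f g)
  | |- continuity_2d_pt (fun u v => @?f u v + @?g u v) _ _ =>
      apply (continuity_2d_pt_plus f g)
  | |- continuity_2d_pt (fun u v => @?f u v - @?g u v) _ _ =>
      apply (continuity_2d_pt_minus f g)
  | |- continuity_2d_pt (fun u v => - @?f u v) _ _ =>
      apply (continuity_2d_pt_opp f)
  | |- continuity_2d_pt (fun u v => exp (@?g u v)) _ _ =>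
      apply (continuity_1d_2d_pt_comp exp g);
      [apply derivable_continuous_pt, derivable_pt_exp | ]
  | |- continuity_2d_pt (fun u v => cos (@?g u v)) _ _ =>
      apply (continuity_1d_2d_pt_comp cos g); [apply continuity_cos | ]
  | |- continuity_2d_pt (fun u v => sin (@?g u v)) _ _ =>
      apply (continuity_1d_2d_pt_comp sin g); [apply continuity_sin | ]
  end.

Lemma continuity_2d_rotated_gamma_dphi (mu th phi y : R) :
  0 < y -> continuity_2d_pt (rotated_gamma_dphi mu th) phi y.
Proof.
  intros Hy. unfold rotated_gamma_dphi.
  continuity_2d.
  apply (continuity_1d_2d_pt_comp (fun v => Rpower v (mu - 1)) (fun _ v => v)).
  - apply continuity_pt_filterlim, continuous_Rpower, Hy.
  - apply continuity_2d_pt_id2.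
Qed.

Lemma continuous_rotated_gamma (mu th phi y : R) :
  0 < y -> continuous (rotated_gamma mu th phi) y.
Proof.
  intros Hy. unfold rotated_gamma.
  apply (ex_derive_continuous (V := R_NormedModule)).
  auto_derive. apply ex_derive_Rpower, Hy.
Qed.

Lemma ex_RInt_rotated_gamma (mu th phi a X : R) :
  0 < a <= X -> ex_RInt (rotated_gamma mu th phi) a X.
Proof.
  intros Ha. apply (ex_RInt_continuous (V := R_CompleteNormedModule)).
  rewrite Rmin_left, Rmax_right by lra. intros y Hy.
  apply continuous_rotated_gamma. lra.
Qed.

(** Cauchy's theorem differentiated in the angle: as the segment turns, its integral changes only
    through the arcs at radii [X] and [a]. *)
Lemma is_derive_RInt_rotated_gamma (mu th phi a X : R) :
  0 < a <= X ->
  is_derive (fun p => RInt (rotated_gamma mu th p) a X) phi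
    (rotated_gamma_flux mu th phi X - rotated_gamma_flux mu th phi a).
Proof.
  intros Ha.
  assert (E : forall u v, Derive (fun z => rotated_gamma mu th z v) u
                          = rotated_gamma_dphi mu th u v)
    by (intros; apply is_derive_unique, is_derive_rotated_gamma).
  assert (D := is_derive_RInt_param (rotated_gamma mu th) a X phi).
  rewrite Rmin_left, Rmax_right in D by lra.
  assert (I : RInt (fun t => Derive (fun u => rotated_gamma mu th u t) phi) a X
     = rotated_gamma_flux mu th phi X - rotated_gamma_flux mu th phi a).
  { rewrite (RInt_ext _ (rotated_gamma_dphi mu th phi)) by (intros; apply E).
    apply is_RInt_unique.
    apply (is_RInt_derive (V := R_CompleteNormedModule)
             (rotated_gamma_flux mu th phi));
      rewrite Rmin_left, Rmax_right by lra; intros y Hy.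
    - apply is_derive_rotated_gamma_flux. lra.
    - unfold rotated_gamma_dphi.
      apply (ex_derive_continuous (V := R_NormedModule)).
      auto_derive. repeat split; apply ex_derive_Rpower; lra. }
  rewrite <- I. apply D.
  - apply filter_forall. intros p t Ht. eexists.
    apply is_derive_rotated_gamma.
  - intros t Ht.
    apply (continuity_2d_pt_ext (rotated_gamma_dphi mu th)).
    + intros; symmetry; apply E.
    + apply continuity_2d_rotated_gamma_dphi. lra.
  - apply filter_forall. intros p. apply ex_RInt_rotated_gamma, Ha.
Qed.

(** A weak Jordan inequality. If [cos x >= 1/4], the mean value theorem gives it; otherwise
    [sin x ^ 2] exceeds [15/16], while [x / 4 <= PI / 8 <= 1/2]. *)
Lemma quarter_le_sin (x : R) : 0 <= x <= PI / 2 -> x / 4 <= sin x.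
Proof.
  intros Hx. pose proof PI_4.
  destruct (Rle_lt_dec (1 / 4) (cos x)) as [Hc|Hc].
  - destruct (Req_dec x 0) as [->|Hx0]; [rewrite sin_0; lra | ].
    destruct (MVT_cor2 sin cos 0 x) as [c [He Hcx]].
    + lra.
    + intros c _. apply derivable_pt_lim_sin.
    + rewrite sin_0 in He.
      assert (cos x <= cos c) by (apply cos_decr_1; lra). nra.
  - assert (0 <= cos x) by (apply cos_ge_0; lra).
    assert (0 <= sin x) by (apply sin_ge_0; lra).
    pose proof (sin2_cos2 x). unfold Rsqr in *. nra.
Qed.

(* [cos phi >= (PI/2 - phi)/4] makes the arc at radius [X] contribute
   [O(X^(mu-1))]. *)
Lemma RInt_rotated_gamma_quarter_turn (mu th a X : R) :
  0 < a <= X ->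
  Rabs (RInt (rotated_gamma mu th (PI / 2)) a X
        - RInt (rotated_gamma mu th 0) a X)
  <= 4 * Rpower X (mu - 1) + 2 * Rpower a mu.
Proof.
  intros Ha. pose proof PI_RGT_0. pose proof PI_4.
  pose proof (Rpower_pos X (mu - 1)). pose proof (Rpower_pos a mu).
  (* [G] is a primitive in the angle of the bounds for the two arcs. The outer arc contributes at
     most [4 X^(mu-1)], the inner one at most [a^mu PI / 2 <= 2 a^mu]. *)
  set (G := fun p => 4 * Rpower X (mu - 1) * exp (- (X * ((PI / 2 - p) / 4)))
                     + Rpower a mu * p).
  apply Rle_trans with (G (PI / 2) - G 0).
  - apply (abs_increment_le (fun p => RInt (rotated_gamma mu th p) a X)
       (fun p => rotated_gamma_flux mu th p X - rotated_gamma_flux mu th p a)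
       G (fun p => Rpower X mu * exp (- (X * ((PI / 2 - p) / 4)))
                   + Rpower a mu)).
    + lra.
    + intros p _. apply is_derive_RInt_rotated_gamma, Ha.
    + intros p _. unfold G. auto_derive; [trivial | ].
      rewrite Rpower_minus_one by lra.
      unfold Rminus, Rdiv. field. lra.
    + intros p Hp.
      assert (Hc : (PI / 2 - p) / 4 <= cos p)
        by (rewrite cos_sin; replace (PI / 2 + p) with (PI - (PI / 2 - p)) by lra;
            rewrite sin_PI_x; apply quarter_le_sin; lra).
      assert (F : forall y, 0 < y -> Rabs (rotated_gamma_flux mu th p y)
                  <= Rpower y mu * exp (- (y * ((PI / 2 - p) / 4)))).
      { intros y Hy. unfold rotated_gamma_flux.
        rewrite Rabs_Ropp, !Rabs_mult.
        rewrite (Rabs_pos_eq (Rpower y mu)) by (left; apply Rpower_pos).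
        apply Rmult_le_compat_l; [left; apply Rpower_pos | ].
        rewrite Rabs_pos_eq by (left; apply exp_pos).
        assert (Rabs (sin (mu * p + th - y * sin p)) <= 1)
          by (apply Rabs_le, SIN_bound).
        assert (exp (- (y * cos p)) <= exp (- (y * ((PI / 2 - p) / 4)))).
        { destruct (Rle_lt_or_eq_dec (y * ((PI / 2 - p) / 4)) (y * cos p)) as [L|L].
          - apply Rmult_le_compat_l; lra.
          - left. apply exp_increasing. lra.
          - rewrite L. lra. }
        pose proof (exp_pos (- (y * cos p))).
        pose proof (Rabs_pos (sin (mu * p + th - y * sin p))). nra. }
      unfold Rminus.
      eapply Rle_trans; [apply Rabs_triang | ]. rewrite Rabs_Ropp.
      apply Rplus_le_compat; [apply F; lra | ].
      apply Rle_trans with (1 := F a (proj1 Ha)).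
      rewrite <- (Rmult_1_r (Rpower a mu)) at 2.
      apply Rmult_le_compat_l; [left; apply Rpower_pos | ].
      rewrite <- exp_0.
      assert (0 <= a * ((PI / 2 - p) / 4)) by (apply Rmult_le_pos; lra).
      destruct (Req_dec (a * ((PI / 2 - p) / 4)) 0) as [Z|Z].
      * rewrite Z, Ropp_0. lra.
      * left. apply exp_increasing. lra.
  - unfold G. replace (X * ((PI / 2 - PI / 2) / 4)) with 0 by field.
    rewrite Ropp_0, exp_0.
    pose proof (exp_pos (- (X * ((PI / 2 - 0) / 4)))). nra.
Qed.

(** * Improper integrals and the Gamma function *)

(** A Cauchy criterion with a rate: [A] and [B] control the integral near the two ends, which yields
    the limit and survives in it as the truncation error. The sums [A x + A y] and [B x + B y] make
    the bounds independent of the order of [x] and [y]. *)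
Lemma improper_RInt (Fa Fb : (R -> Prop) -> Prop)
    (PFa : ProperFilter Fa) (PFb : ProperFilter Fb)
    (f A B : R -> R) (Da Db : R -> Prop) :
  Fa Da -> Fb Db ->
  (forall x y, Da x \/ Db x -> Da y \/ Db y -> ex_RInt f x y) ->
  (forall x y, Da x -> Da y -> Rabs (RInt f x y) <= A x + A y) ->
  (forall x y, Db x -> Db y -> Rabs (RInt f x y) <= B x + B y) ->
  filterlim A Fa (locally 0) -> filterlim B Fb (locally 0) ->
  exists l : R, is_RInt_gen f Fa Fb l /\
    forall a b, Da a -> Db b -> Rabs (l - RInt f a b) <= A a + B b.
Proof.
  intros HDa HDb Hex HA HB LA LB.
  set (F := fun ab : R * R => RInt f (fst ab) (snd ab)).
  assert (Hdiff : forall a b a' b', Da a -> Db b -> Da a' -> Db b' ->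
            Rabs (F (a, b) - F (a', b')) <= (A a + A a') + (B b + B b')).
  { intros a b a' b' Ha Hb Ha' Hb'. unfold F. simpl.
    rewrite (RInt_split f a a' b), (RInt_split f a' b' b) by auto.
    replace (RInt f a a' + (RInt f a' b' + RInt f b' b) - RInt f a' b')
      with (RInt f a a' + RInt f b' b) by ring.
    eapply Rle_trans; [apply Rabs_triang | ].
    pose proof (HA a a' Ha Ha'). pose proof (HB b' b Hb' Hb). lra. }
  assert (SA : forall e, 0 < e -> Fa (fun x => Da x /\ A x < e)).
  { intros e He. apply filter_and; [exact HDa | ].
    apply (filter_imp (fun x => ball 0 (mkposreal e He) (A x))).
    - intros x Hx. change (Rabs (A x - 0) < e) in Hx.
      rewrite Rminus_0_r in Hx.
      apply Rle_lt_trans with (2 := Hx), Rle_abs.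
    - apply (LA _ (locally_ball 0 (mkposreal e He))). }
  assert (SB : forall e, 0 < e -> Fb (fun x => Db x /\ B x < e)).
  { intros e He. apply filter_and; [exact HDb | ].
    apply (filter_imp (fun x => ball 0 (mkposreal e He) (B x))).
    - intros x Hx. change (Rabs (B x - 0) < e) in Hx.
      rewrite Rminus_0_r in Hx.
      apply Rle_lt_trans with (2 := Hx), Rle_abs.
    - apply (LB _ (locally_ball 0 (mkposreal e He))). }
  assert (SAB : forall e, 0 < e -> filter_prod Fa Fb
     (fun ab => (Da (fst ab) /\ A (fst ab) < e) /\ Db (snd ab) /\ B (snd ab) < e)).
  { intros e He.
    apply Filter_prod with (1 := SA e He) (2 := SB e He). simpl. auto. }
  destruct (proj1 (filterlim_locally_cauchy (U := R_CompleteSpace)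
                     (F := filter_prod Fa Fb) F)) as [l Hl].
  { intros e.
    assert (He : 0 < e / 4) by (destruct e; simpl; lra).
    exists (fun ab => (Da (fst ab) /\ A (fst ab) < e / 4)
                      /\ Db (snd ab) /\ B (snd ab) < e / 4).
    split; [apply SAB, He | ].
    intros [a b] [a' b']; simpl. intros [[? ?] [? ?]] [[? ?] [? ?]].
    change (Rabs (F (a', b') - F (a, b)) < e).
    eapply Rle_lt_trans; [apply Hdiff; assumption | lra]. }
  exists l. split.
  - apply (filterlimi_lim_ext_loc F).
    + apply (filter_imp (fun ab => (Da (fst ab) /\ A (fst ab) < 1)
                                   /\ Db (snd ab) /\ B (snd ab) < 1)).
      * intros ab [[? _] [? _]].
        apply (RInt_correct (V := R_CompleteNormedModule)). auto.
      * apply SAB; lra.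
    + exact Hl.
  - intros a b Ha Hb.
    apply le_epsilon. intros e He.
    assert (He3 : 0 < e / 3) by lra.
    assert (L : filter_prod Fa Fb (fun ab => Rabs (F ab - l) < e / 3))
      by exact (Hl _ (locally_ball l (mkposreal _ He3))).
    (* One pair near the ends has both tails and the distance to the limit below [e / 3]; comparing
       with it leaves only [A a + B b]. *)
    destruct (filter_ex _ (filter_and _ _ L (SAB _ He3)))
      as [[a' b'] [H1 [[H2 H3] [H4 H5]]]]. simpl in *.
    specialize (Hdiff a' b' a b H2 H4 Ha Hb).
    replace (l - RInt f a b)
      with ((F (a', b') - F (a, b)) - (F (a', b') - l)) by (unfold F; simpl; ring).
    eapply Rle_trans; [apply Rabs_triang | ]. rewrite Rabs_Ropp. lra.
Qed.

Lemma filterlim_Rpower_at_right_0 (K mu : R) :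
  0 < mu -> filterlim (fun x => K * Rpower x mu) (at_right 0) (locally 0).
Proof.
  intros Hmu. apply filterlim_locally. intros e.
  assert (HK := Rabs_pos K).
  assert (He : 0 < e / (Rabs K + 1))
    by (apply Rdiv_lt_0_compat; [destruct e | ]; simpl; lra).
  exists (mkposreal _ (Rpower_pos (e / (Rabs K + 1)) (/ mu))).
  intros x Hx Hx0.
  change (Rabs (x - 0) < Rpower (e / (Rabs K + 1)) (/ mu)) in Hx.
  change (Rabs (K * Rpower x mu - 0) < e).
  rewrite Rminus_0_r in *.
  rewrite Rabs_pos_eq in Hx by lra.
  rewrite Rabs_mult, (Rabs_pos_eq (Rpower x mu)) by (left; apply Rpower_pos).
  assert (Hp : Rpower x mu < e / (Rabs K + 1)).
  { apply Rlt_le_trans with (Rpower (Rpower (e / (Rabs K + 1)) (/ mu)) mu).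
    - apply Rlt_Rpower_l; lra.
    - rewrite Rpower_mult, Rinv_l, Rpower_1 by lra. lra. }
  pose proof (Rpower_pos x mu).
  apply Rle_lt_trans with (Rabs K * (e / (Rabs K + 1))).
  - apply Rmult_le_compat_l; lra.
  - replace (Rabs K * (e / (Rabs K + 1)))
      with (e - e / (Rabs K + 1)) by (field; lra). lra.
Qed.

Lemma filterlim_Rpower_p_infty (a : R) :
  a < 0 -> filterlim (fun x => Rpower x a) (Rbar_locally p_infty) (locally 0).
Proof.
  intros Ha. apply filterlim_locally. intros e.
  exists (Rmax 1 (Rpower e (/ a))). intros x Hx.
  assert (1 < x) by (apply Rle_lt_trans with (2 := Hx), Rmax_l).
  assert (Hx2 : Rpower e (/ a) < x) by (apply Rle_lt_trans with (2 := Hx), Rmax_r).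
  change (Rabs (Rpower x a - 0) < e). rewrite Rminus_0_r.
  rewrite Rabs_pos_eq by (left; apply Rpower_pos).
  assert (He : 0 < e) by apply cond_pos.
  rewrite <- (Rpower_1 e He).
  replace 1 with (/ a * a) by (apply Rinv_l; lra).
  rewrite <- Rpower_mult.
  replace a with (- (- a)) by ring. rewrite !(Rpower_Ropp _ (- a)).
  apply Rinv_lt_contravar.
  - apply Rmult_lt_0_compat; apply Rpower_pos.
  - replace (- - a) with a by ring.
    apply Rlt_Rpower_l; [lra | split; [apply Rpower_pos | exact Hx2]].
Qed.

Lemma RInt_power_weight_le (mu M : R) (f : R -> R) (a b : R) :
  0 < mu -> 0 < a <= b -> ex_RInt f a b ->
  (forall y, a <= y <= b -> Rabs (f y) <= M * Rpower y (mu - 1)) ->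
  Rabs (RInt f a b) <= M / mu * Rpower b mu - M / mu * Rpower a mu.
Proof.
  intros Hmu Hab Hf H.
  apply (RInt_abs_le_primitive f (fun y => M * Rpower y (mu - 1))
           (fun y => M / mu * Rpower y mu)).
  - lra.
  - exact Hf.
  - intros y Hy. auto_derive; [apply ex_derive_Rpower; lra | ].
    rewrite Derive_Rpower by lra. field. lra.
  - intros y Hy. apply (ex_derive_continuous (V := R_NormedModule)).
    auto_derive. apply ex_derive_Rpower; lra.
  - exact H.
Qed.

(** For [mu < 1] the power is largest at [X], and the remaining exponential integrates to at most
    [exp (- X) <= 1]. *)
Lemma RInt_gamma_tail (mu X Y : R) :
  mu < 1 -> 0 < X <= Y ->
  Rabs (RInt (fun y => Rpower y (mu - 1) * exp (- y)) X Y) <= Rpower X (mu - 1).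
Proof.
  intros Hmu HX.
  pose proof (Rpower_pos X (mu - 1)).
  apply Rle_trans with (- Rpower X (mu - 1) * exp (- Y)
                        - - Rpower X (mu - 1) * exp (- X)).
  - apply (RInt_abs_le_primitive _ (fun y => Rpower X (mu - 1) * exp (- y))
             (fun y => - Rpower X (mu - 1) * exp (- y))).
    + lra.
    + apply (ex_RInt_continuous (V := R_CompleteNormedModule)).
      rewrite Rmin_left, Rmax_right by lra. intros y Hy.
      apply (ex_derive_continuous (V := R_NormedModule)).
      auto_derive. apply ex_derive_Rpower; lra.
    + intros y _. auto_derive; [trivial | ring].
    + intros y _. apply (ex_derive_continuous (V := R_NormedModule)).
      auto_derive. trivial.
    + intros y Hy.
      pose proof (exp_pos (- y)).
      rewrite Rabs_pos_eq
        by (apply Rmult_le_pos; left; [apply Rpower_pos | assumption]).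
      apply Rmult_le_compat_r; [lra | ].
      apply Rpower_le_antitone; lra.
  - pose proof (exp_pos (- Y)).
    assert (exp (- X) < exp 0) by (apply exp_increasing; lra).
    rewrite exp_0 in *. nra.
Qed.

Lemma Gamma_truncation (mu a X : R) :
  0 < mu < 1 -> 0 < a -> 0 < X ->
  Rabs (Gamma mu - RInt (fun y => Rpower y (mu - 1) * exp (- y)) a X)
  <= 1 / mu * Rpower a mu + Rpower X (mu - 1).
Proof.
  intros Hmu Ha HX.
  set (f := fun y => Rpower y (mu - 1) * exp (- y)).
  assert (Hf : forall x y, 0 < x -> 0 < y -> ex_RInt f x y).
  { intros x y Hx Hy. apply (ex_RInt_continuous (V := R_CompleteNormedModule)).
    intros z Hz. apply (ex_derive_continuous (V := R_NormedModule)).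
    assert (0 < Rmin x y) by (apply Rmin_glb_lt; lra).
    unfold f. auto_derive. apply ex_derive_Rpower; lra. }
  destruct (improper_RInt (at_right 0) (Rbar_locally p_infty) _ _ f
              (fun x => 1 / mu * Rpower x mu) (fun x => Rpower x (mu - 1))
              (fun x => 0 < x) (fun x => 0 < x)) as [l [Hl Hb]].
  - exists (mkposreal 1 Rlt_0_1). auto.
  - exists 0. auto.
  - intros x y Hx Hy. apply Hf; tauto.
  - assert (L : forall x y, 0 < x <= y ->
              Rabs (RInt f x y) <= 1 / mu * Rpower x mu + 1 / mu * Rpower y mu).
    { intros x y Hxy.
      assert (H := RInt_power_weight_le mu 1 f x y (proj1 Hmu) Hxy).
      assert (0 < 1 / mu) by (apply Rdiv_lt_0_compat; lra).
      pose proof (Rpower_pos x mu).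
      apply Rle_trans with (1 / mu * Rpower y mu - 1 / mu * Rpower x mu);
        [apply H | nra].
      - apply Hf; lra.
      - intros z Hz. unfold f. rewrite Rabs_mult, !Rabs_pos_eq
          by (left; (apply exp_pos || apply Rpower_pos)).
        assert (exp (- z) < exp 0) by (apply exp_increasing; lra).
        rewrite exp_0 in *. pose proof (Rpower_pos z (mu - 1)). nra. }
    intros x y Hx Hy. destruct (Rle_dec x y).
    + apply L; lra.
    + rewrite <- opp_RInt_swap by (apply Hf; assumption).
      unfold opp; simpl. rewrite Rabs_Ropp, Rplus_comm. apply L; lra.
  - assert (L : forall x y, 0 < x <= y ->
              Rabs (RInt f x y) <= Rpower x (mu - 1) + Rpower y (mu - 1)).
    { intros x y Hxy. pose proof (RInt_gamma_tail mu x y (proj2 Hmu) Hxy).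
      pose proof (Rpower_pos y (mu - 1)). unfold f. lra. }
    intros x y Hx Hy. destruct (Rle_dec x y).
    + apply L; lra.
    + rewrite <- opp_RInt_swap by (apply Hf; assumption).
      unfold opp; simpl. rewrite Rabs_Ropp, Rplus_comm. apply L; lra.
  - apply filterlim_Rpower_at_right_0. lra.
  - apply filterlim_Rpower_p_infty. lra.
  - change (Gamma mu) with (RInt_gen f (at_right 0) (Rbar_locally p_infty)).
    rewrite (is_RInt_gen_unique (V := R_CompleteNormedModule) _ _ Hl).
    apply Hb; assumption.
Qed.

Lemma RInt_power_cos_approx_unit (mu th a X : R) :
  0 < mu < 1 -> 0 < a <= X ->
  Rabs (RInt (fun y => Rpower y (mu - 1) * cos (y + th)) a X
        - Gamma mu * cos (mu * PI / 2 + th))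
  <= 5 * Rpower X (mu - 1) + (2 + 1 / mu) * Rpower a mu.
Proof.
  intros Hmu Ha.
  (* With this phase the ray at angle [PI / 2] carries [cos (y + th)], and the real ray carries the
     Gamma integrand times the constant [cos ph = cos (mu * PI / 2 + th)]. *)
  set (ph := - (mu * PI / 2) - th).
  assert (Q := RInt_rotated_gamma_quarter_turn mu ph a X Ha).
  assert (G := Gamma_truncation mu a X Hmu (proj1 Ha)).
  specialize (G ltac:(lra)).
  rewrite (RInt_ext (rotated_gamma mu ph (PI / 2))
             (fun y => Rpower y (mu - 1) * cos (y + th))) in Q.
  2: { intros y _. unfold rotated_gamma.
       rewrite cos_PI2, sin_PI2, Rmult_0_r, Ropp_0, exp_0, Rmult_1_l.
       f_equal. rewrite <- cos_neg. f_equal. unfold ph. field. }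
  rewrite (RInt_ext (rotated_gamma mu ph 0)
             (fun y => cos ph * (Rpower y (mu - 1) * exp (- y)))) in Q.
  2: { intros y _. unfold rotated_gamma. rewrite cos_0, sin_0.
       replace (mu * 0 + ph - y * 0) with ph by ring.
       as_R. rewrite Rmult_1_r. ring. }
  assert (E : ex_RInt (fun y => Rpower y (mu - 1) * exp (- y)) a X).
  { apply (ex_RInt_continuous (V := R_CompleteNormedModule)).
    rewrite Rmin_left, Rmax_right by lra. intros y Hy.
    apply (ex_derive_continuous (V := R_NormedModule)).
    auto_derive. apply ex_derive_Rpower; lra. }
  pose proof (RInt_scal (V := R_CompleteNormedModule) _ a X (cos ph) E) as S.
  unfold scal in S; simpl in S; unfold mult in S; simpl in S.
  rewrite S in Q. clear S.
  replace (cos ph) with (cos (mu * PI / 2 + th)) in Q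
    by (unfold ph; rewrite <- cos_neg; f_equal; ring).
  set (I := RInt (fun y => Rpower y (mu - 1) * exp (- y)) a X) in *.
  set (J := RInt (fun y => Rpower y (mu - 1) * cos (y + th)) a X) in *.
  set (c := cos (mu * PI / 2 + th)) in *.
  replace (J - Gamma mu * c) with ((J - c * I) - c * (Gamma mu - I)) by ring.
  eapply Rle_trans; [apply Rabs_triang | ]. rewrite Rabs_Ropp, Rabs_mult.
  assert (Rabs c <= 1) by (apply Rabs_le, COS_bound).
  pose proof (Rabs_pos c). pose proof (Rabs_pos (Gamma mu - I)). nra.
Qed.

(** * The value of Gamma at 1/2 *)

Lemma Rpower_sqr (x a : R) : 0 < x -> Rpower (x ^ 2) a = Rpower x (2 * a).
Proof.
  intros Hx. rewrite <- (Rpower_pow 2) by exact Hx. apply Rpower_mult.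
Qed.

Lemma RInt_scal_R (f : R -> R) (a b k : R) :
  ex_RInt f a b -> RInt (fun x => k * f x) a b = k * RInt f a b.
Proof. apply (RInt_scal (V := R_CompleteNormedModule)). Qed.

Lemma ex_RInt_cont (f : R -> R) (a b : R) :
  a <= b -> (forall x, a <= x <= b -> continuous f x) -> ex_RInt f a b.
Proof.
  intros Hab H. apply (ex_RInt_continuous (V := R_CompleteNormedModule)).
  rewrite Rmin_left, Rmax_right by lra. exact H.
Qed.

(** The substitution [y = s^2], whose Jacobian cancels the weight at [mu = 1/2]. It serves the
    Gaussian and the Fresnel integral alike. *)
Lemma RInt_sqrt_weight (f : R -> R) (a b : R) :
  0 < a <= b -> (forall y, continuous f y) ->
  RInt (fun y => Rpower y (1 / 2 - 1) * f y) (a ^ 2) (b ^ 2)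
  = 2 * RInt (fun s => f (s ^ 2)) a b.
Proof.
  intros Hab Hf.
  assert (cs : forall s, continuous (fun s => f (s ^ 2)) s).
  { intros s. apply (continuous_comp (fun s => s ^ 2) f); [ | apply Hf].
    apply (ex_derive_continuous (V := R_NormedModule)). auto_derive. trivial. }
  rewrite <- RInt_scal_R by (apply ex_RInt_cont; [lra | auto]).
  symmetry.
  rewrite <- (RInt_comp (V := R_CompleteNormedModule)
    (fun y => Rpower y (1 / 2 - 1) * f y) (fun s => s ^ 2) (fun s => 2 * s));
    rewrite ?Rmin_left, ?Rmax_right by lra.
  - apply RInt_ext. rewrite Rmin_left, Rmax_right by lra. intros s Hs.
    unfold scal; simpl; unfold mult; simpl.
    change (s * (s * 1)) with (s ^ 2).
    rewrite Rpower_sqr by lra.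
    replace (2 * (1 / 2 - 1)) with (- (1)) by field.
    rewrite Rpower_Ropp, Rpower_1 by lra.
    change (2 * f (s ^ 2) = 2 * s * (/ s * f (s ^ 2)) :> R). field. lra.
  - intros s Hs. apply (continuous_mult (fun y => Rpower y (1 / 2 - 1)) f).
    + apply continuous_Rpower. nra.
    + apply Hf.
  - intros s Hs. split.
    + auto_derive; [trivial | ring].
    + apply (ex_derive_continuous (V := R_NormedModule)).
      auto_derive. trivial.
Qed.

Definition gauss_prim (x : R) : R := RInt (fun s => exp (- s ^ 2)) 0 x.

(** The classical companion of the Gaussian integral: its derivative is opposite to that of
    [gauss_prim x ^ 2]. The sum is therefore constant, equal to its value [atan 1 = PI / 4] at [0],
    and [gauss_aux] vanishes at infinity. *)
Definition gauss_aux (x : R) : R :=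
  RInt (fun t => exp (- (x ^ 2 * (1 + t ^ 2))) / (1 + t ^ 2)) 0 1.

Lemma continuous_gauss (s : R) : continuous (fun s => exp (- s ^ 2)) s.
Proof.
  apply (ex_derive_continuous (V := R_NormedModule)). auto_derive. trivial.
Qed.

Lemma is_derive_gauss_prim (x : R) :
  is_derive gauss_prim x (exp (- x ^ 2)).
Proof.
  apply (is_derive_RInt (V := R_NormedModule) (fun s => exp (- s ^ 2))
           gauss_prim 0).
  - apply filter_forall. intros y.
    apply (RInt_correct (V := R_CompleteNormedModule)).
    apply (ex_RInt_continuous (V := R_CompleteNormedModule)).
    intros; apply continuous_gauss.
  - apply continuous_gauss.
Qed.

Lemma gauss_prim_scaled (x : R) :
  RInt (fun t => x * exp (- (x * t) ^ 2)) 0 1 = gauss_prim x.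
Proof.
  assert (H := RInt_comp_lin (V := R_CompleteNormedModule)
                 (fun s => exp (- s ^ 2)) x 0 0 1).
  replace (x * 0 + 0) with 0 in H by ring.
  replace (x * 1 + 0) with x in H by ring.
  unfold gauss_prim. rewrite <- H.
  - apply RInt_ext. intros t _. rewrite Rplus_0_r. reflexivity.
  - apply (ex_RInt_continuous (V := R_CompleteNormedModule)).
    intros; apply continuous_gauss.
Qed.

(** Differentiating in [x] cancels the denominator [1 + t^2]; the exponential then factors into
    [exp (- x^2)] and a rescaled Gaussian. *)
Lemma is_derive_gauss_aux (x : R) :
  is_derive gauss_aux x (- (2 * exp (- x ^ 2) * gauss_prim x)).
Proof.
  set (k := fun x t => exp (- (x ^ 2 * (1 + t ^ 2))) / (1 + t ^ 2)).
  set (dk := fun x t => - (2 * x) * exp (- (x ^ 2 * (1 + t ^ 2)))).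
  assert (P : forall t, 1 + t ^ 2 <> 0) by (intros t; nra).
  assert (D : forall x t, is_derive (fun x => k x t) x (dk x t)).
  { intros y t. unfold k, dk. auto_derive; [trivial | ].
    simpl. field. nra. }
  assert (E : forall u v, Derive (fun z => k z v) u = dk u v)
    by (intros; apply is_derive_unique, D).
  assert (I : RInt (fun t => Derive (fun u => k u t) x) 0 1
              = - (2 * exp (- x ^ 2) * gauss_prim x)).
  { rewrite (RInt_ext _ (fun t => - (2 * exp (- x ^ 2))
                                  * (x * exp (- (x * t) ^ 2)))).
    - rewrite RInt_scal_R, gauss_prim_scaled; [as_R; ring | ].
      apply ex_RInt_cont; [lra | ]. intros t _.
      apply (ex_derive_continuous (V := R_NormedModule)). auto_derive. trivial.
    - intros t _. rewrite E. unfold dk.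
      replace (- (x ^ 2 * (1 + t ^ 2))) with (- x ^ 2 + - (x * t) ^ 2) by ring.
      rewrite exp_plus. as_R. ring. }
  rewrite <- I. apply (is_derive_RInt_param k 0 1 x).
  - apply filter_forall. intros y t _. eexists. apply D.
  - intros t _. apply (continuity_2d_pt_ext dk); [intros; symmetry; apply E | ].
    unfold dk. simpl. continuity_2d.
  - apply filter_forall. intros y. apply ex_RInt_cont; [lra | ].
    intros t _. apply (ex_derive_continuous (V := R_NormedModule)).
    unfold k. auto_derive. apply P.
Qed.

Lemma gauss_prim_sqr (x : R) : gauss_prim x ^ 2 + gauss_aux x = PI / 4.
Proof.
  assert (D : forall y, is_derive (fun y => gauss_prim y ^ 2 + gauss_aux y) y 0).
  { intros y. pose proof (is_derive_gauss_prim y) as D1.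
    pose proof (is_derive_gauss_aux y) as D2.
    auto_derive.
    - split; [eexists; exact D1 | split; [eexists; exact D2 | trivial]].
    - assert (E1 : Derive (fun x : R => gauss_prim x) y = exp (- y ^ 2))
        by apply is_derive_unique, D1.
      assert (E2 : Derive (fun x : R => gauss_aux x) y
                   = - (2 * exp (- y ^ 2) * gauss_prim y))
        by apply is_derive_unique, D2.
      rewrite E1, E2. ring. }
  assert (Z : gauss_prim 0 ^ 2 + gauss_aux 0 = PI / 4).
  { unfold gauss_prim.
    rewrite (RInt_point (V := R_CompleteNormedModule)).
    unfold gauss_aux.
    rewrite (RInt_ext _ (fun t => / (1 + t ^ 2))).
    - rewrite (is_RInt_unique (V := R_CompleteNormedModule) _ 0 1
                 (atan 1 - atan 0)).
      + rewrite atan_0, atan_1. unfold zero; simpl. ring.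
      + apply (is_RInt_derive (V := R_CompleteNormedModule) atan).
        * intros t _. apply is_derive_Reals, derivable_pt_lim_atan.
        * intros t _. apply (ex_derive_continuous (V := R_NormedModule)).
          auto_derive. simpl. nra.
    - intros t _. replace (- (0 ^ 2 * (1 + t ^ 2))) with 0 by ring.
      rewrite exp_0. unfold Rdiv. apply Rmult_1_l. }
  rewrite <- Z.
  destruct (MVT_gen (fun y => gauss_prim y ^ 2 + gauss_aux y) 0 x (fun _ => 0))
    as [c [_ Hc]].
  - intros; apply D.
  - intros y _. apply continuity_pt_filterlim.
    apply (ex_derive_continuous (V := R_NormedModule)
             (fun y => gauss_prim y ^ 2 + gauss_aux y)).
    eexists; apply D.
  - lra.
Qed.

Lemma gauss_prim_bounds (x : R) : 0 <= x -> 0 <= gauss_prim x <= x.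
Proof.
  intros Hx.
  assert (E : ex_RInt (fun s => exp (- s ^ 2)) 0 x)
    by (apply ex_RInt_cont; [exact Hx | intros; apply continuous_gauss]).
  split.
  - apply RInt_ge_0; [exact Hx | exact E | ]. intros; left; apply exp_pos.
  - apply Rle_trans with (1 := Rle_abs _).
    replace x with ((x - 0) * 1) at 2 by ring.
    apply abs_RInt_le_const; [exact Hx | exact E | ].
    intros s Hs. rewrite Rabs_pos_eq by (left; apply exp_pos).
    rewrite <- exp_0. destruct (Req_dec s 0) as [->|Hs0].
    + replace (- 0 ^ 2) with 0 by ring. lra.
    + left. apply exp_increasing. nra.
Qed.

Lemma gauss_aux_bounds (x : R) : 0 < x -> 0 <= gauss_aux x <= / x ^ 2.
Proof.
  intros Hx.
  assert (E : ex_RInt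
     (fun t => exp (- (x ^ 2 * (1 + t ^ 2))) / (1 + t ^ 2)) 0 1).
  { apply ex_RInt_cont; [lra | ]. intros t _.
    apply (ex_derive_continuous (V := R_NormedModule)).
    auto_derive. simpl; nra. }
  assert (H1 : forall t, 0 < / (1 + t ^ 2) <= 1).
  { intros t. split; [apply Rinv_0_lt_compat; nra | ].
    rewrite <- Rinv_1. apply Rinv_le_contravar; nra. }
  assert (Hx2 : 0 < x ^ 2) by nra.
  split.
  - apply RInt_ge_0; [lra | exact E | ]. intros t _.
    apply Rmult_le_pos; [left; apply exp_pos | left; apply H1].
  - apply Rle_trans with (1 := Rle_abs _).
    replace (/ x ^ 2) with ((1 - 0) * / x ^ 2) by ring.
    apply abs_RInt_le_const; [lra | exact E | ].
    intros t _. specialize (H1 t).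
    assert (0 < exp (- (x ^ 2 * (1 + t ^ 2))) <= / x ^ 2).
    { split; [apply exp_pos | ].
      rewrite exp_Ropp. apply Rinv_le_contravar; [exact Hx2 | ].
      pose proof (exp_ineq1_le (x ^ 2 * (1 + t ^ 2))). nra. }
    unfold Rdiv. rewrite Rabs_pos_eq by nra. nra.
Qed.

Lemma Gamma_half_approx (x : R) :
  1 <= x -> Rabs (Gamma (1 / 2) - 2 * gauss_prim x) <= 5 * / x.
Proof.
  intros Hx.
  assert (Hi : 0 < / x <= 1).
  { split; [apply Rinv_0_lt_compat; lra | ].
    rewrite <- Rinv_1. apply Rinv_le_contravar; lra. }
  (* These truncation points become [1/x] and [x] after the square root and cost [3 / x]. The
     Gaussian piece on [[0, 1/x]], taken twice, adds the remaining [2 / x]. *)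
  assert (H := Gamma_truncation (1 / 2) ((/ x) ^ 2) (x ^ 2)).
  specialize (H ltac:(lra) ltac:(nra) ltac:(nra)).
  rewrite (RInt_sqrt_weight (fun y => exp (- y))) in H.
  2: lra.
  2: { intros y. apply (ex_derive_continuous (V := R_NormedModule)).
       auto_derive. trivial. }
  rewrite !Rpower_sqr in H by lra.
  replace (2 * (1 / 2)) with 1 in H by field.
  replace (2 * (1 / 2 - 1)) with (- (1)) in H by field.
  rewrite Rpower_Ropp, !Rpower_1 in H by lra.
  replace (1 / (1 / 2) * / x + / x) with (3 * / x) in H by (field; lra).
  assert (S : gauss_prim x = gauss_prim (/ x)
                             + RInt (fun s => exp (- s ^ 2)) (/ x) x).
  { apply RInt_split; (apply ex_RInt_cont; [lra | ]; intros;
                       apply continuous_gauss). }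
  pose proof (gauss_prim_bounds (/ x) ltac:(lra)) as B.
  rewrite S.
  set (I := RInt (fun s => exp (- s ^ 2)) (/ x) x) in *.
  apply Rabs_le. apply Rabs_le_between in H. lra.
Qed.

Lemma Gamma_half : Gamma (1 / 2) = sqrt PI.
Proof.
  set (G := Gamma (1 / 2)).
  assert (HA : forall e, 0 < e < 1 -> exists g, 0 <= g /\
     Rabs (G - 2 * g) <= 5 * e /\ Rabs (4 * g ^ 2 - PI) <= 4 * e ^ 2).
  { intros e He. exists (gauss_prim (/ e)).
    assert (1 <= / e)
      by (rewrite <- Rinv_1; apply Rinv_le_contravar; lra).
    split; [ | split].
    - apply gauss_prim_bounds. lra.
    - rewrite <- (Rinv_inv e) at 2. apply Gamma_half_approx. assumption.
    - pose proof (gauss_prim_sqr (/ e)).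
      pose proof (gauss_aux_bounds (/ e) ltac:(lra)) as B.
      rewrite pow_inv, Rinv_inv in B.
      apply Rabs_le. lra. }
  (* The sign, inherited from [0 <= g], selects the root of [G ^ 2 = PI]. *)
  assert (G0 : 0 <= G).
  { apply (le_of_le_power 0 G 5 1 1); [lra | lra | ].
    intros e He. rewrite Rpower_1 by lra.
    destruct (HA e He) as [g [Hg [H1 _]]].
    apply Rabs_le_between in H1. lra. }
  assert (G2 : Rabs (G ^ 2 - PI) <= 0).
  (* For [e < 1] one has [G + 2 * g <= 2 * G + 5] and [4 * e ^ 2 <= 4 * e], which gives the
     constant. *)
  { apply (le_of_le_power _ 0 (5 * (2 * G + 5) + 4) 1 1); [lra | lra | ].
    intros e He. rewrite Rpower_1 by lra.
    destruct (HA e He) as [g [Hg [H1 H2]]].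
    replace (G ^ 2 - PI) with ((G - 2 * g) * (G + 2 * g) + (4 * g ^ 2 - PI)) by ring.
    eapply Rle_trans; [apply Rabs_triang | ]. rewrite Rabs_mult.
    assert (2 * g <= G + 5 * e) by (apply Rabs_le_between in H1; lra).
    rewrite (Rabs_pos_eq (G + 2 * g)) by lra.
    pose proof (Rabs_pos (G - 2 * g)).
    assert (Rabs (G - 2 * g) * (G + 2 * g) <= 5 * e * (2 * G + 5)).
    { apply Rmult_le_compat; lra. }
    nra. }
  pose proof (Rabs_pos (G ^ 2 - PI)).
  assert (G ^ 2 - PI = 0)
    by (apply Rabs_eq_0; lra).
  replace PI with (G ^ 2) by lra.
  rewrite sqrt_pow2; lra.
Qed.

(** * Fresnel integrals *)

Lemma RInt_power_cos_approx (mu lam th a X : R) :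
  0 < mu < 1 -> 0 < lam -> 0 < a <= X ->
  Rabs (RInt (fun w => Rpower w (mu - 1) * cos (lam * w + th)) a X
        - Rpower lam (- mu) * (Gamma mu * cos (mu * PI / 2 + th)))
  <= 5 * (Rpower X (mu - 1) / lam) + (2 + 1 / mu) * Rpower a mu.
Proof.
  intros Hmu Hlam Ha.
  assert (H := RInt_power_cos_approx_unit mu th (lam * a) (lam * X) Hmu).
  specialize (H ltac:(nra)).
  assert (E : forall w, 0 < w -> continuous
                (fun w => Rpower w (mu - 1) * cos (lam * w + th)) w).
  { intros w Hw. apply (ex_derive_continuous (V := R_NormedModule)).
    auto_derive. apply ex_derive_Rpower, Hw. }
  assert (E1 : forall w, 0 < w -> continuous
                (fun w => Rpower w (mu - 1) * cos (w + th)) w).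
  { intros w Hw. apply (ex_derive_continuous (V := R_NormedModule)).
    auto_derive. apply ex_derive_Rpower, Hw. }
  assert (S : RInt (fun y => Rpower y (mu - 1) * cos (y + th)) (lam * a) (lam * X)
     = Rpower lam mu * RInt (fun w => Rpower w (mu - 1) * cos (lam * w + th)) a X).
  { rewrite <- RInt_scal_R by (apply ex_RInt_cont; [lra | intros; apply E; lra]).
    assert (C := RInt_comp_lin (V := R_CompleteNormedModule)
      (fun y => Rpower y (mu - 1) * cos (y + th)) lam 0 a X).
    rewrite !Rplus_0_r in C. rewrite <- C.
    - apply RInt_ext. rewrite Rmin_left, Rmax_right by lra. intros w Hw.
      rewrite Rplus_0_r. unfold scal; simpl; unfold mult; simpl. as_R.
      rewrite <- Rpower_mult_distr by lra.
      rewrite (Rpower_minus_one lam) by lra. field. lra.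
    - apply ex_RInt_cont; [nra | intros; apply E1; nra]. }
  rewrite S in H.
  set (I := RInt (fun w => Rpower w (mu - 1) * cos (lam * w + th)) a X) in *.
  rewrite <- !Rpower_mult_distr in H by lra.
  rewrite (Rpower_minus_one lam) in H by lra.
  rewrite Rpower_Ropp.
  assert (P := Rpower_pos lam mu).
  set (p := Rpower lam mu) in *.
  set (g := Gamma mu * cos (mu * PI / 2 + th)) in *.
  replace (I - / p * g) with (/ p * (p * I - g)) by (field; lra).
  rewrite Rabs_mult, (Rabs_pos_eq (/ p))
    by (left; apply Rinv_0_lt_compat, P).
  apply (Rmult_le_reg_l p); [exact P | ].
  rewrite <- Rmult_assoc, Rinv_r, Rmult_1_l by lra.
  apply Rle_trans with (1 := H). right. field. lra.
Qed.

(** For [t > 0] this is minus the tail [int_r^inf cos (t y^2 + th) dy], the primitive of the chirp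
    that vanishes at infinity. The subtracted constant is the complete Fresnel integral over the
    half line. *)
Definition fresnel_remainder (t th r : R) : R :=
  RInt (fun y => cos (t * y ^ 2 + th)) 0 r
  - sqrt PI / 2 * (Rpower t (- (1 / 2)) * cos (PI / 4 + th)).

Lemma continuous_chirp (t th y : R) : continuous (fun y => cos (t * y ^ 2 + th)) y.
Proof.
  apply (ex_derive_continuous (V := R_NormedModule)). auto_derive. trivial.
Qed.

Lemma ex_RInt_chirp (t th a b : R) : ex_RInt (fun y => cos (t * y ^ 2 + th)) a b.
Proof.
  apply (ex_RInt_continuous (V := R_CompleteNormedModule)).
  intros; apply continuous_chirp.
Qed.

Lemma RInt_chirp_le (t th r : R) :
  0 <= r -> Rabs (RInt (fun y => cos (t * y ^ 2 + th)) 0 r) <= r.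
Proof.
  intros Hr. replace r with ((r - 0) * 1) at 2 by ring.
  apply abs_RInt_le_const; [exact Hr | apply ex_RInt_chirp | ].
  intros y _. apply Rabs_le, COS_bound.
Qed.

Lemma fresnel_remainder_le_inv (t th r : R) :
  0 < t -> 0 < r -> Rabs (fresnel_remainder t th r) <= 5 / 2 / (t * r).
Proof.
  intros Ht Hr.
  (* The error [3 a] consists of [2 a] from the Gamma approximation at [mu = 1/2], after halving,
     and of [a] from the piece [[0, a]]. *)
  apply (le_of_le_power _ _ 3 1 r); [lra | lra | ]. intros a Ha.
  rewrite Rpower_1 by lra.
  assert (H := RInt_power_cos_approx (1 / 2) t th (a ^ 2) (r ^ 2)).
  specialize (H ltac:(lra) Ht ltac:(nra)).
  rewrite (RInt_sqrt_weight (fun w => cos (t * w + th))) in H.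
  2: lra.
  2: { intros y. apply (ex_derive_continuous (V := R_NormedModule)).
       auto_derive. trivial. }
  rewrite Gamma_half, !Rpower_sqr in H by lra.
  replace (2 * (1 / 2)) with 1 in H by field.
  replace (2 * (1 / 2 - 1)) with (- (1)) in H by field.
  rewrite (Rpower_Ropp r 1), !Rpower_1 in H by lra.
  replace (2 + 1 / (1 / 2)) with 4 in H by field.
  replace (1 / 2 * PI / 2) with (PI / 4) in H by field.
  unfold fresnel_remainder.
  rewrite (RInt_split _ 0 a r) by apply ex_RInt_chirp.
  assert (B := RInt_chirp_le t th a ltac:(lra)).
  set (I := RInt (fun y => cos (t * y ^ 2 + th)) a r) in *.
  set (J := RInt (fun y => cos (t * y ^ 2 + th)) 0 a) in *.
  replace (5 / 2 / (t * r)) with (5 * (/ r / t) / 2) by (field; lra).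
  apply Rabs_le. apply Rabs_le_between in H. apply Rabs_le_between in B. lra.
Qed.

Lemma sqrt_PI_le_2 : sqrt PI <= 2.
Proof.
  replace 2 with (sqrt 4) by (replace 4 with (2 ^ 2) by ring;
                              apply sqrt_pow2; lra).
  apply sqrt_le_1_alt, PI_4.
Qed.

(** In the scaled variable [x = t^(1/2) r] the two bounds are [t^(-1/2)] and [t^(-1/2) / x] up to
    constants. Since [1 - 2 delta] lies in [(-1, 0)], the power [x^(1 - 2 delta)] dominates
    [min (1, 1/x)]. *)
Lemma fresnel_remainder_le_power (delta t th r : R) :
  1 / 2 < delta < 1 -> 0 < t -> 0 < r ->
  Rabs (fresnel_remainder t th r)
  <= 3 * (Rpower t (- delta) * Rpower r (1 - 2 * delta)).
Proof.
  intros Hd Ht Hr.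
  set (x := Rpower t (1 / 2) * r).
  assert (Pt := Rpower_pos t (1 / 2)).
  assert (Hx : 0 < x) by (apply Rmult_lt_0_compat; lra).
  assert (T : Rpower t (1 / 2) * Rpower t (1 / 2) = t).
  { rewrite <- Rpower_plus. replace (1 / 2 + 1 / 2) with 1 by field.
    apply Rpower_1, Ht. }
  assert (E : Rpower t (- delta) * Rpower r (1 - 2 * delta)
              = Rpower t (- (1 / 2)) * Rpower x (1 - 2 * delta)).
  { unfold x. rewrite <- Rpower_mult_distr, Rpower_mult by lra.
    rewrite <- Rmult_assoc, <- Rpower_plus. do 2 f_equal. field. }
  rewrite E.
  assert (Qt := Rpower_pos t (- (1 / 2))).
  assert (I : Rpower t (- (1 / 2)) = / Rpower t (1 / 2)) by apply Rpower_Ropp.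
  destruct (Rle_lt_dec x 1) as [L|L].
  - assert (1 <= Rpower x (1 - 2 * delta)).
    { rewrite <- (Rpower_O x) at 1 by exact Hx. apply Rpower_le_exponent; lra. }
    apply Rle_trans with (3 * Rpower t (- (1 / 2))); [ | nra].
    unfold fresnel_remainder, Rminus.
    eapply Rle_trans; [apply Rabs_triang | ]. rewrite Rabs_Ropp.
    assert (B := RInt_chirp_le t th r ltac:(lra)).
    assert (r <= Rpower t (- (1 / 2))).
    { rewrite I. apply (Rmult_le_reg_l (Rpower t (1 / 2))); [exact Pt | ].
      rewrite Rinv_r by lra. exact L. }
    rewrite !Rabs_mult, (Rabs_pos_eq (Rpower t (- (1 / 2)))) by lra.
    assert (Rabs (cos (PI / 4 + th)) <= 1) by (apply Rabs_le, COS_bound).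
    pose proof (Rabs_pos (cos (PI / 4 + th))).
    pose proof sqrt_PI_le_2. pose proof (sqrt_pos PI).
    rewrite (Rabs_pos_eq (sqrt PI / 2)) by lra.
    assert (sqrt PI / 2 * (Rpower t (- (1 / 2)) * Rabs (cos (PI / 4 + th)))
            <= 1 * (Rpower t (- (1 / 2)) * 1)).
    { apply Rmult_le_compat; try lra.
      - apply Rmult_le_pos; lra.
      - apply Rmult_le_compat_l; lra. }
    lra.
  - assert (R1 : / x <= Rpower x (1 - 2 * delta)).
    { rewrite <- (Rpower_1 x) at 1 by exact Hx. rewrite <- Rpower_Ropp.
      apply Rle_Rpower; lra. }
    apply Rle_trans with (1 := fresnel_remainder_le_inv t th r Ht Hr).
    apply Rle_trans with (3 * (Rpower t (- (1 / 2)) * / x)).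
    + replace (Rpower t (- (1 / 2)) * / x) with (/ (t * r)).
      * assert (0 < / (t * r)) by (apply Rinv_0_lt_compat; nra).
        unfold Rdiv at 1. lra.
      * rewrite I. unfold x. rewrite <- T at 1. field. lra.
    + apply Rmult_le_compat_l; [lra | ].
      apply Rmult_le_compat_l; lra.
Qed.

Lemma is_derive_fresnel_remainder (t th r : R) :
  is_derive (fresnel_remainder t th) r (cos (t * r ^ 2 + th)).
Proof.
  assert (D : is_derive (fun r => RInt (fun y => cos (t * y ^ 2 + th)) 0 r) r
                (cos (t * r ^ 2 + th))).
  { apply (is_derive_RInt (V := R_NormedModule)
             (fun y => cos (t * y ^ 2 + th)) _ 0).
    - apply filter_forall. intros y.
      apply (RInt_correct (V := R_CompleteNormedModule)), ex_RInt_chirp.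
    - apply continuous_chirp. }
  unfold fresnel_remainder.
  set (c := sqrt PI / 2 * (Rpower t (- (1 / 2)) * cos (PI / 4 + th))).
  replace (cos (t * r ^ 2 + th)) with (minus (cos (t * r ^ 2 + th)) 0)
    by (unfold minus, plus, opp; simpl; as_R; ring).
  apply (is_derive_minus (V := R_NormedModule)); [exact D | ].
  apply (is_derive_const (V := R_NormedModule) c).
Qed.

(** By convention [Rpower 0 mu] is 1, so the primitive [Rpower y mu] breaks down at [0]. The piece
    [[0, a]] is estimated instead by a bound [N] of the continuous [f] and disappears with [a]. *)
Lemma RInt_power_weight_le_0 (mu M : R) (f : R -> R) (b : R) :
  0 < mu -> 0 < b -> (forall y, 0 <= y <= b -> continuous f y) ->
  (forall y, 0 < y <= b -> Rabs (f y) <= M * Rpower y (mu - 1)) ->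
  Rabs (RInt f 0 b) <= M / mu * Rpower b mu.
Proof.
  intros Hmu Hb Hc H.
  assert (E : forall x y, 0 <= x -> x <= y -> y <= b -> ex_RInt f x y)
    by (intros; apply ex_RInt_cont; [lra | intros; apply Hc; lra]).
  destruct (ex_RInt_ub f 0 b (E 0 b ltac:(lra) ltac:(lra) ltac:(lra)))
    as [N HN].
  rewrite Rmin_left, Rmax_right in HN by lra.
  assert (HM : 0 <= M).
  { specialize (H b ltac:(lra)). pose proof (Rabs_pos (f b)).
    pose proof (Rpower_pos b (mu - 1)). nra. }
  apply (le_of_le_power _ _ N 1 b); [lra | lra | ]. intros a Ha.
  rewrite Rpower_1 by lra.
  rewrite (RInt_split f 0 a b) by (apply E; lra).
  eapply Rle_trans; [apply Rabs_triang | ].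
  assert (B1 : Rabs (RInt f 0 a) <= (a - 0) * N).
  { apply abs_RInt_le_const; [lra | apply E; lra | ].
    intros y Hy. apply HN. lra. }
  assert (B2 := RInt_power_weight_le mu M f a b Hmu ltac:(lra)
                  (E a b ltac:(lra) ltac:(lra) ltac:(lra))).
  specialize (B2 ltac:(intros; apply H; lra)).
  assert (0 <= M / mu * Rpower a mu).
  { apply Rmult_le_pos; [ | left; apply Rpower_pos].
    apply Rmult_le_pos; [exact HM | left; apply Rinv_0_lt_compat, Hmu]. }
  lra.
Qed.

(** Integration by parts with [fresnel_remainder] as primitive of the chirp. At [0] it equals minus
    the half-line Fresnel integral, which produces the leading term; at [b] the inverse bound
    applies. Under the integral the power bound is integrable at [0], and this gives the denominator
    [2 - 2 * delta]. *)
Lemma stationary_phase_half_line (delta t th b M : R) (F dF : R -> R) :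
  1 / 2 < delta < 1 -> 0 < t -> 0 < b ->
  (forall r, 0 <= r <= b -> is_derive F r (dF r)) ->
  (forall r, 0 <= r <= b -> continuous dF r) ->
  (forall r, 0 <= r <= b -> Rabs (dF r) <= M) ->
  Rabs (RInt (fun r => F r * cos (t * r ^ 2 + th)) 0 b
        - sqrt PI / 2 * (Rpower t (- (1 / 2)) * cos (PI / 4 + th)) * F 0)
  <= 5 / 2 / (t * b) * Rabs (F b)
     + 3 * M / (2 - 2 * delta) * (Rpower t (- delta) * Rpower b (2 - 2 * delta)).
Proof.
  intros Hd Ht Hb HF HdF HM.
  rewrite (RInt_by_parts F dF (fresnel_remainder t th)).
  2: lra.
  2: exact HF.
  2: intros; apply is_derive_fresnel_remainder.
  2: exact HdF.
  2: intros; apply continuous_chirp.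
  assert (Z : fresnel_remainder t th 0
              = - (sqrt PI / 2 * (Rpower t (- (1 / 2)) * cos (PI / 4 + th)))).
  { unfold fresnel_remainder. rewrite (RInt_point (V := R_CompleteNormedModule)).
    unfold zero; simpl. ring. }
  rewrite Z.
  set (c := sqrt PI / 2 * (Rpower t (- (1 / 2)) * cos (PI / 4 + th))).
  set (I := RInt (fun x => dF x * fresnel_remainder t th x) 0 b).
  replace (F b * fresnel_remainder t th b - F 0 * - c - I - c * F 0)
    with (F b * fresnel_remainder t th b + - I) by ring.
  eapply Rle_trans; [apply Rabs_triang | ]. rewrite Rabs_Ropp.
  apply Rplus_le_compat.
  - rewrite Rabs_mult, Rmult_comm.
    apply Rmult_le_compat_r; [apply Rabs_pos | ].
    apply fresnel_remainder_le_inv; assumption.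
  - unfold I.
    replace (3 * M / (2 - 2 * delta)
             * (Rpower t (- delta) * Rpower b (2 - 2 * delta)))
      with (3 * M * Rpower t (- delta) / (2 - 2 * delta)
            * Rpower b (2 - 2 * delta)) by (field; lra).
    apply RInt_power_weight_le_0; [lra | exact Hb | | ].
    + intros y Hy. apply (continuous_mult dF (fresnel_remainder t th)).
      * apply HdF, Hy.
      * apply (ex_derive_continuous (V := R_NormedModule)).
        eexists. apply is_derive_fresnel_remainder.
    + intros y Hy. rewrite Rabs_mult.
      assert (B := fresnel_remainder_le_power delta t th y Hd Ht (proj1 Hy)).
      specialize (HM y ltac:(lra)).
      replace (2 - 2 * delta - 1) with (1 - 2 * delta) by ring.
      apply Rle_trans
        with (M * (3 * (Rpower t (- delta) * Rpower y (1 - 2 * delta)))).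
      * apply Rmult_le_compat; try assumption; apply Rabs_pos.
      * right. ring.
Qed.

(** * The endpoint contribution *)

Lemma Rpower_le_inv (x a : R) : 0 < x <= 1 -> -1 <= a -> Rpower x a <= / x.
Proof.
  intros Hx Ha. rewrite <- (Rpower_1 x) at 2 by lra. rewrite <- Rpower_Ropp.
  apply Rpower_le_exponent; lra.
Qed.

(** Integration by parts against the phase derivative [2 t (q - s)], which is at least [t s] in
    absolute value up to [s/2]. The extra factor [q/s] in the bound on [k] tames the singular
    weight, so the result does not depend on [a]: the two boundary terms give [2], the integral
    gives [2 / mu]. *)
Lemma nonstationary_phase_le (mu N t s th a : R) (k dk : R -> R) :
  0 < mu -> 0 < t -> 0 < s -> 0 < a <= s / 2 ->
  (forall q, a <= q <= s / 2 -> is_derive k q (dk q)) ->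
  (forall q, a <= q <= s / 2 -> continuous dk q) ->
  (forall q, a <= q <= s / 2 -> Rabs (k q) <= N * (Rpower q (mu - 1) * (q / s))) ->
  (forall q, a <= q <= s / 2 -> Rabs (dk q) <= N * (Rpower q (mu - 1) / s)) ->
  Rabs (RInt (fun q => k q * cos (t * (q - s) ^ 2 + th)) a (s / 2))
  <= N * (2 + 2 / mu) * (Rpower s mu / (t * s ^ 2)).
Proof.
  intros Hmu Ht Hs Ha Dk Cdk Hk Hdk.
  set (g := fun q => k q / (2 * t * (q - s))).
  set (dg := fun q => dk q / (2 * t * (q - s)) - k q / (2 * t * (q - s) ^ 2)).
  assert (Hts : 0 < t * s ^ 2)
    by (apply Rmult_lt_0_compat; [lra | apply pow_lt; lra]).
  assert (HN : 0 <= N).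
  { specialize (Hdk a ltac:(lra)). pose proof (Rabs_pos (dk a)).
    assert (0 < Rpower a (mu - 1) / s)
      by (apply Rdiv_lt_0_compat; [apply Rpower_pos | lra]). nra. }
  assert (Ck : forall q, a <= q <= s / 2 -> continuous k q).
  { intros q Hq. apply (ex_derive_continuous (V := R_NormedModule)).
    eexists; apply Dk, Hq. }
  assert (Ch : forall m q, a <= q <= s / 2 ->
             continuous (fun q => / (2 * t * (q - s) ^ m)) q).
  { intros m q Hq. apply (ex_derive_continuous (V := R_NormedModule)).
    auto_derive.
    apply Rmult_integral_contrapositive_currified; [lra | ].
    apply pow_nonzero. lra. }
  assert (Dg : forall q, a <= q <= s / 2 -> is_derive g q (dg q)).
  { intros q Hq. unfold g. assert (D := Dk q Hq).
    assert (D' : Derive (fun x : R => k x) q = dk q)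
      by apply is_derive_unique, D.
    auto_derive.
    - split; [eexists; exact D | ].
      split; [apply Rmult_integral_contrapositive_currified; lra | trivial].
    - rewrite D'. unfold dg. field. lra. }
  assert (Cdg : forall q, a <= q <= s / 2 -> continuous dg q).
  { intros q Hq. unfold dg. apply (continuous_minus (V := R_NormedModule)).
    - apply (continuous_mult dk (fun q => / (2 * t * (q - s)))).
      + apply Cdk, Hq.
      + apply (continuous_ext (fun q => / (2 * t * (q - s) ^ 1))).
        * intros; rewrite pow_1; reflexivity.
        * apply Ch, Hq.
    - apply (continuous_mult k (fun q => / (2 * t * (q - s) ^ 2))).
      + apply Ck, Hq.
      + apply Ch, Hq. }
  rewrite (RInt_ext _ (fun q => g q * (2 * t * (q - s) * cos (t * (q - s) ^ 2 + th)))).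
  2: { rewrite Rmin_left, Rmax_right by lra. intros q Hq. unfold g. as_R.
       field. lra. }
  rewrite (RInt_by_parts g dg (fun q => sin (t * (q - s) ^ 2 + th))).
  2: lra.
  2: exact Dg.
  2: { intros q _. auto_derive; [trivial | ]. unfold Rminus. simpl. ring. }
  2: exact Cdg.
  2: { intros q _. apply (ex_derive_continuous (V := R_NormedModule)).
       auto_derive. trivial. }
  assert (Sin : forall x, Rabs (sin x) <= 1) by (intros; apply Rabs_le, SIN_bound).
  assert (Bg : forall q, a <= q <= s / 2 -> Rabs (g q) <= N * (Rpower s mu / (t * s ^ 2))).
  { intros q Hq. unfold g, Rdiv at 1. rewrite Rabs_mult, Rabs_inv.
    rewrite (Rabs_left (2 * t * (q - s))) by nra.
    specialize (Hk q Hq).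
    assert (P : Rpower q (mu - 1) * (q / s) <= Rpower s mu / s).
    { rewrite Rpower_minus_one by lra.
      replace (Rpower q mu / q * (q / s)) with (Rpower q mu / s) by (field; lra).
      apply Rmult_le_compat_r; [left; apply Rinv_0_lt_compat, Hs | ].
      apply Rle_Rpower_l; lra. }
    apply Rle_trans with (N * (Rpower s mu / s) * / (t * s)).
    - apply Rmult_le_compat; [apply Rabs_pos | | | ].
      + left; apply Rinv_0_lt_compat; nra.
      + apply Rle_trans with (1 := Hk). apply Rmult_le_compat_l; assumption.
      + apply Rinv_le_contravar; nra.
    - right. field. lra. }
  assert (Bdg : forall q, a <= q <= s / 2 ->
            Rabs (dg q) <= 2 * N / (t * s ^ 2) * Rpower q (mu - 1)).
  { intros q Hq. unfold dg, Rminus at 1.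
    eapply Rle_trans; [apply Rabs_triang | ]. rewrite Rabs_Ropp.
    specialize (Hk q Hq). specialize (Hdk q Hq).
    unfold Rdiv at 1 2. rewrite !Rabs_mult, !Rabs_inv.
    rewrite (Rabs_left (2 * t * (q - s))) by nra.
    rewrite (Rabs_pos_eq (2 * t * (q - s) ^ 2)) by (apply Rmult_le_pos; [lra | apply pow2_ge_0]).
    assert (P := Rpower_pos q (mu - 1)).
    assert (P1 : Rabs (dk q) * / - (2 * t * (q - s))
                 <= N * (Rpower q (mu - 1) / s) * / (t * s)).
    { apply Rmult_le_compat; [apply Rabs_pos | | exact Hdk | ].
      + left; apply Rinv_0_lt_compat; nra.
      + apply Rinv_le_contravar; nra. }
    assert (P2 : Rabs (k q) * / (2 * t * (q - s) ^ 2)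
                 <= N * (Rpower q (mu - 1) * (1 / 2)) * / (t * s ^ 2 / 2)).
    { apply Rmult_le_compat; [apply Rabs_pos | | | ].
      + left; apply Rinv_0_lt_compat, Rmult_lt_0_compat; [lra | nra].
      + apply Rle_trans with (1 := Hk).
        apply Rmult_le_compat_l; [exact HN | ].
        apply Rmult_le_compat_l; [lra | ].
        apply (Rmult_le_reg_r s); [exact Hs | ].
        unfold Rdiv. rewrite Rmult_assoc, Rinv_l by lra. lra.
      + apply Rinv_le_contravar; [lra | ].
        assert (s ^ 2 / 4 <= (q - s) ^ 2) by nra. nra. }
    eapply Rle_trans; [apply Rplus_le_compat; [exact P1 | exact P2] | ].
    right. field. lra. }
  assert (BI := RInt_power_weight_le mu (2 * N / (t * s ^ 2))
                 (fun x => dg x * sin (t * (x - s) ^ 2 + th)) a (s / 2) Hmu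
                 ltac:(lra)).
  match type of BI with ?A -> ?B -> _ =>
    assert (X1 : A); [ | assert (X2 : B); [ | specialize (BI X1 X2)]] end.
  { apply ex_RInt_cont; [lra | ]. intros q Hq.
    apply (continuous_mult dg (fun x => sin (t * (x - s) ^ 2 + th))).
    - apply Cdg, Hq.
    - apply (ex_derive_continuous (V := R_NormedModule)). auto_derive. trivial. }
  { intros q Hq. rewrite Rabs_mult.
    pose proof (Sin (t * (q - s) ^ 2 + th)). specialize (Bdg q Hq).
    pose proof (Rabs_pos (dg q)). nra. }
  set (I := RInt (fun x => dg x * sin (t * (x - s) ^ 2 + th)) a (s / 2)) in *.
  assert (F : 0 <= / (t * s ^ 2)) by (left; apply Rinv_0_lt_compat, Hts).
  assert (BI' : Rabs I <= 2 / mu * (N * (Rpower s mu / (t * s ^ 2)))).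
  { apply Rle_trans with (1 := BI).
    assert (Ps : Rpower (s / 2) mu <= Rpower s mu) by (apply Rle_Rpower_l; lra).
    pose proof (Rpower_pos a mu).
    assert (0 <= 2 * N / (t * s ^ 2) / mu).
    { unfold Rdiv. repeat apply Rmult_le_pos; try lra; try exact F.
      left. apply Rinv_0_lt_compat, Hmu. }
    apply Rle_trans with (2 * N / (t * s ^ 2) / mu * Rpower s mu); [nra | ].
    right. field. lra. }
  assert (B1 := Bg (s / 2) ltac:(lra)).
  assert (B2 := Bg a ltac:(lra)).
  assert (S1 := Sin (t * (s / 2 - s) ^ 2 + th)).
  assert (S2 := Sin (t * (a - s) ^ 2 + th)).
  set (x1 := sin (t * (s / 2 - s) ^ 2 + th)) in *.
  set (x2 := sin (t * (a - s) ^ 2 + th)) in *.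
  assert (T1 : Rabs (g (s / 2) * x1) <= N * (Rpower s mu / (t * s ^ 2))).
  { rewrite Rabs_mult. pose proof (Rabs_pos (g (s / 2))).
    pose proof (Rabs_pos x1). nra. }
  assert (T2 : Rabs (g a * x2) <= N * (Rpower s mu / (t * s ^ 2))).
  { rewrite Rabs_mult. pose proof (Rabs_pos (g a)).
    pose proof (Rabs_pos x2). nra. }
  replace (N * (2 + 2 / mu) * (Rpower s mu / (t * s ^ 2)))
    with (N * (Rpower s mu / (t * s ^ 2)) + N * (Rpower s mu / (t * s ^ 2))
          + 2 / mu * (N * (Rpower s mu / (t * s ^ 2)))) by ring.
  apply Rabs_le. apply Rabs_le_between in T1, T2, BI'. lra.
Qed.

(* With [w = q - q^2/(2s)] one has [(q-s)^2 = s^2 - 2sw], so that the model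
   amplitude [w^(mu-1) dw/dq = q^(mu-1) endpoint_factor mu s q] turns the
   quadratic phase into the linear one of the Gamma integral. *)
Definition endpoint_factor (mu s q : R) : R :=
  Rpower (1 - q / (2 * s)) (mu - 1) * (1 - q / s).

Definition endpoint_factor' (mu s q : R) : R :=
  (mu - 1) * Rpower (1 - q / (2 * s)) (mu - 1 - 1) * - / (2 * s) * (1 - q / s)
  - Rpower (1 - q / (2 * s)) (mu - 1) / s.

Lemma endpoint_base_bounds (s q : R) :
  0 < s -> 0 <= q <= s / 2 -> 3 / 4 <= 1 - q / (2 * s) <= 1.
Proof.
  intros Hs Hq.
  assert (0 <= q / (2 * s) <= 1 / 4).
  { split.
    - apply Rmult_le_pos; [lra | left; apply Rinv_0_lt_compat; lra].
    - apply (Rmult_le_reg_r (2 * s)); [lra | ].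
      unfold Rdiv. rewrite Rmult_assoc, Rinv_l by lra. lra. }
  lra.
Qed.

Lemma is_derive_endpoint_factor (mu s q : R) :
  0 < s -> 0 <= q <= s / 2 ->
  is_derive (endpoint_factor mu s) q (endpoint_factor' mu s q).
Proof.
  intros Hs Hq. unfold endpoint_factor.
  assert (B := endpoint_base_bounds s q Hs Hq).
  assert (D1 : is_derive (fun q => 1 - q / (2 * s)) q (- / (2 * s)))
    by (auto_derive; [trivial | field; lra]).
  assert (D2 : is_derive (fun q => Rpower (1 - q / (2 * s)) (mu - 1)) q
                 (scal (- / (2 * s))
                   ((mu - 1) * Rpower (1 - q / (2 * s)) (mu - 1 - 1)))).
  { apply (is_derive_comp (fun x => Rpower x (mu - 1))
             (fun q => 1 - q / (2 * s))); [ | exact D1].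
    apply is_derive_Rpower. lra. }
  assert (D3 : is_derive (fun q => 1 - q / s) q (- / s))
    by (auto_derive; [trivial | field; lra]).
  replace (endpoint_factor' mu s q)
    with (plus (mult (scal (- / (2 * s))
                        ((mu - 1) * Rpower (1 - q / (2 * s)) (mu - 1 - 1)))
                  (1 - q / s))
            (mult (Rpower (1 - q / (2 * s)) (mu - 1)) (- / s))).
  - apply (is_derive_mult (fun q => Rpower (1 - q / (2 * s)) (mu - 1))
             (fun q => 1 - q / s)); [exact D2 | exact D3 | ].
    intros; apply Rmult_comm.
  - unfold endpoint_factor', plus, scal, mult; simpl; unfold mult; simpl.
    as_R. unfold Rdiv. ring.
Qed.

Lemma continuous_endpoint_factor' (mu s q : R) :
  0 < s -> 0 <= q <= s / 2 -> continuous (endpoint_factor' mu s) q.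
Proof.
  intros Hs Hq. assert (B := endpoint_base_bounds s q Hs Hq).
  unfold endpoint_factor'.
  apply (ex_derive_continuous (V := R_NormedModule)).
  auto_derive. unfold Rminus, Rdiv in B.
  repeat split; apply ex_derive_Rpower; lra.
Qed.

(** The base stays in [[3/4, 1]] up to [s/2], so its powers with exponents [mu - 2] and [mu - 1] are
    at most [16/9 < 2]. *)
Lemma endpoint_factor'_bound (mu s q : R) :
  0 < mu < 1 -> 0 < s -> 0 <= q <= s / 2 ->
  Rabs (endpoint_factor' mu s q) <= 3 / s.
Proof.
  intros Hmu Hs Hq. assert (B := endpoint_base_bounds s q Hs Hq).
  unfold endpoint_factor'.
  set (x := 1 - q / (2 * s)) in *.
  assert (P1 : 0 < Rpower x (mu - 1 - 1) <= 2).
  { split; [apply Rpower_pos | ].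
    apply Rle_trans with (Rpower x (- (2))).
    - apply Rpower_le_exponent; lra.
    - rewrite Rpower_Ropp. change 2 with (INR 2) at 1.
      rewrite Rpower_pow by lra.
      apply Rle_trans with (/ (9 / 16)); [ | lra].
      apply Rinv_le_contravar; nra. }
  assert (P2 : 0 < Rpower x (mu - 1) <= 2).
  { split; [apply Rpower_pos | ].
    apply Rle_trans with (/ x); [apply Rpower_le_inv; lra | ].
    apply Rle_trans with (/ (3 / 4)); [ | lra].
    apply Rinv_le_contravar; lra. }
  assert (P3 : 0 <= 1 - q / s <= 1).
  { replace (1 - q / s) with (2 * x - 1) by (unfold x; field; lra). lra. }
  set (y := Rpower x (mu - 1 - 1)) in *. set (z := Rpower x (mu - 1)) in *.
  set (w := 1 - q / s) in *.
  replace ((mu - 1) * y * - / (2 * s) * w - z / s)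
    with (((1 - mu) * y * w / 2 - z) / s) by (field; lra).
  unfold Rdiv at 1. rewrite Rabs_mult, (Rabs_pos_eq (/ s))
    by (left; apply Rinv_0_lt_compat, Hs).
  apply Rmult_le_compat_r; [left; apply Rinv_0_lt_compat, Hs | ].
  assert (0 <= y * w <= 2) by nra.
  assert (0 <= (1 - mu) * (y * w) <= 2) by nra.
  apply Rabs_le. nra.
Qed.

Lemma endpoint_expansion (mu M0 M1 t s th a : R) (v dv : R -> R) :
  0 < mu < 1 -> 0 < t -> 0 < s <= 1 -> 0 < a <= s / 2 ->
  (forall q, is_derive v q (dv q)) -> (forall q, continuous dv q) ->
  Rabs (v 0) <= M0 -> (forall q, 0 <= q <= s / 2 -> Rabs (dv q) <= M1) ->
  Rabs (RInt (fun q => Rpower q (mu - 1) * v q * cos (t * (q - s) ^ 2 + th))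
          a (s / 2)
        - Rpower (2 * t * s) (- mu)
          * (Gamma mu * cos (mu * PI / 2 + (- (t * s ^ 2) - th))) * v 0)
  <= (2 * (M1 + 3 * M0) * (2 + 2 / mu) + 7 * M0) * (Rpower s mu / (t * s ^ 2))
     + M0 * (2 + 1 / mu) * Rpower a mu.
Proof.
  intros Hmu Ht Hs Ha Dv Cdv HM0 HM1.
  set (b := endpoint_factor mu s). set (b' := endpoint_factor' mu s).
  set (A := fun q => v q - v 0 * b q).
  set (A' := fun q => dv q - v 0 * b' q).
  assert (Db : forall q, 0 <= q <= s / 2 -> is_derive b q (b' q))
    by (intros; apply is_derive_endpoint_factor; lra).
  assert (DA : forall q, 0 <= q <= s / 2 -> is_derive A q (A' q)).
  { intros q Hq. apply (is_derive_minus (V := R_NormedModule)).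
    - apply Dv.
    - apply (is_derive_scal b q (v 0) (b' q)), Db, Hq. }
  assert (M0p : 0 <= M0) by (pose proof (Rabs_pos (v 0)); lra).
  assert (M1p : 0 <= M1) by (specialize (HM1 0 ltac:(lra));
                             pose proof (Rabs_pos (dv 0)); lra).
  (* [3 M0 / s] bounds the derivative of the model amplitude, and [s <= 1] allows [M1 <= M1 / s]. *)
  set (N := M1 + 3 * M0).
  assert (BA' : forall q, 0 <= q <= s / 2 -> Rabs (A' q) <= N / s).
  { intros q Hq. unfold A', Rminus.
    eapply Rle_trans; [apply Rabs_triang | ]. rewrite Rabs_Ropp, Rabs_mult.
    assert (E := endpoint_factor'_bound mu s q Hmu (proj1 Hs) Hq).
    fold b' in E. specialize (HM1 q Hq).
    assert (I : 1 <= / s) by (rewrite <- Rinv_1; apply Rinv_le_contravar; lra).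
    assert (Rabs (v 0) * Rabs (b' q) <= M0 * (3 / s))
      by (apply Rmult_le_compat; try assumption; apply Rabs_pos).
    unfold N, Rdiv in *. nra. }
  assert (A0 : A 0 = 0).
  { unfold A, b, endpoint_factor. unfold Rdiv. rewrite !Rmult_0_l, !Rminus_0_r.
    rewrite Rpower_base_1. ring. }
  assert (BA : forall q, 0 <= q <= s / 2 -> Rabs (A q) <= N * (q / s)).
  { intros q Hq. rewrite <- (Rminus_0_r (A q)), <- A0.
    replace (N * (q / s)) with (N / s * q - N / s * 0) by (field; lra).
    apply (abs_increment_le A A' (fun q => N / s * q) (fun _ => N / s)).
    - lra.
    - intros x Hx. apply DA; lra.
    - intros x _. auto_derive; [trivial | ring].
    - intros x Hx. apply BA'; lra. }
  set (k := fun q => Rpower q (mu - 1) * A q).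
  set (k' := fun q => (mu - 1) * Rpower q (mu - 1 - 1) * A q
                      + Rpower q (mu - 1) * A' q).
  assert (CA : forall q, a <= q <= s / 2 -> continuous A q).
  { intros q Hq. apply (ex_derive_continuous (V := R_NormedModule)).
    eexists. apply DA. lra. }
  (* The product rule doubles [N]: the derivative of the weight, acting on [A = O(q/s)], and the
     derivative of [A] each contribute [N q^(mu-1) / s]. *)
  assert (K := nonstationary_phase_le mu (2 * N) t s th a k k'
                 (proj1 Hmu) Ht (proj1 Hs) Ha).
  match type of K with ?P1 -> ?P2 -> ?P3 -> ?P4 -> _ =>
    assert (X1 : P1); [ | assert (X2 : P2); [ | assert (X3 : P3);
      [ | assert (X4 : P4); [ | specialize (K X1 X2 X3 X4)]]]] end.
  { intros q Hq. unfold k, k'.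
    apply (is_derive_mult (fun q => Rpower q (mu - 1)) A);
      [apply is_derive_Rpower; lra | apply DA; lra | intros; apply Rmult_comm]. }
  { intros q Hq. unfold k'. apply (continuous_plus (V := R_NormedModule)).
    - apply (continuous_mult (fun q => (mu - 1) * Rpower q (mu - 1 - 1)) A).
      + apply (ex_derive_continuous (V := R_NormedModule)).
        auto_derive. apply ex_derive_Rpower; lra.
      + apply CA, Hq.
    - apply (continuous_mult (fun q => Rpower q (mu - 1)) A').
      + apply continuous_Rpower; lra.
      + unfold A'. apply (continuous_minus (V := R_NormedModule)).
        * apply Cdv.
        * apply (continuous_mult (fun _ => v 0) b'); [apply continuous_const | ].
          apply continuous_endpoint_factor'; lra. }
  { intros q Hq. unfold k. rewrite Rabs_mult.
    assert (P := Rpower_pos q (mu - 1)). rewrite (Rabs_pos_eq (Rpower q _)) by lra.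
    specialize (BA q ltac:(lra)). pose proof (Rabs_pos (A q)). nra. }
  { intros q Hq. unfold k'.
    assert (P := Rpower_pos q (mu - 1)).
    eapply Rle_trans; [apply Rabs_triang | ].
    rewrite (Rpower_minus_one q (mu - 1)) by lra.
    rewrite !Rabs_mult, (Rabs_pos_eq (Rpower q (mu - 1))) by lra.
    rewrite (Rabs_pos_eq (Rpower q (mu - 1) / q))
      by (left; apply Rdiv_lt_0_compat; lra).
    assert (Rabs (mu - 1) <= 1) by (apply Rabs_le; lra).
    assert (Q1 : Rabs (mu - 1) * (Rpower q (mu - 1) / q) * Rabs (A q)
                 <= 1 * (Rpower q (mu - 1) / q) * (N * (q / s))).
    { apply Rmult_le_compat; [ | apply Rabs_pos | | apply BA; lra].
      - apply Rmult_le_pos; [apply Rabs_pos | left; apply Rdiv_lt_0_compat; lra].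
      - apply Rmult_le_compat_r; [left; apply Rdiv_lt_0_compat; lra | lra]. }
    assert (Q2 : Rpower q (mu - 1) * Rabs (A' q) <= Rpower q (mu - 1) * (N / s))
      by (apply Rmult_le_compat_l; [lra | apply BA'; lra]).
    eapply Rle_trans; [apply Rplus_le_compat; [exact Q1 | exact Q2] | ].
    right. field. lra. }
  set (W := fun q => q - q ^ 2 / (2 * s)).
  assert (Wpos : forall q, a <= q <= s / 2 -> W q = q * (1 - q / (2 * s)))
    by (intros; unfold W; field; lra).
  (* Here [t (q - s)^2 + th = - (2 t s W q + ph)]. As cosine is even, the linear phase has the
     positive frequency [2 t s]. *)
  set (ph := - (t * s ^ 2) - th).
  assert (G := RInt_power_cos_approx mu (2 * t * s) ph (W a) (W (s / 2)) Hmu).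
  assert (Ba := endpoint_base_bounds s a (proj1 Hs) ltac:(lra)).
  assert (Wa : 0 < W a <= a) by (rewrite Wpos by lra; nra).
  assert (Ws : W (s / 2) = 3 / 8 * s) by (unfold W; field; lra).
  assert (Waa : W a <= W (s / 2)).
  { replace (W (s / 2)) with (W a + (s / 2 - a) * (1 - (s / 2 + a) / (2 * s)))
      by (unfold W; field; lra).
    assert ((s / 2 + a) / (2 * s) <= 1 / 2).
    { apply (Rmult_le_reg_r (2 * s)); [lra | ].
      unfold Rdiv at 1. rewrite Rmult_assoc, Rinv_l by lra. lra. }
    nra. }
  specialize (G ltac:(apply Rmult_lt_0_compat; lra) ltac:(lra)).
  rewrite <- (RInt_comp (V := R_CompleteNormedModule)
                (fun w => Rpower w (mu - 1) * cos (2 * t * s * w + ph))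
                W (fun q => 1 - q / s)) in G.
  2: { rewrite Rmin_left, Rmax_right by lra. intros q Hq.
       apply (ex_derive_continuous (V := R_NormedModule)).
       auto_derive. apply ex_derive_Rpower.
       assert (Bq := endpoint_base_bounds s q (proj1 Hs) ltac:(lra)).
       rewrite Wpos by lra. nra. }
  2: { intros q _. split.
       - unfold W. auto_derive; [trivial | field; lra].
       - apply (ex_derive_continuous (V := R_NormedModule)).
         auto_derive. trivial. }
  set (f := fun q => k q * cos (t * (q - s) ^ 2 + th)) in *.
  set (g := fun q => scal (1 - q / s)
             (Rpower (W q) (mu - 1) * cos (2 * t * s * W q + ph))) in *.
  change (Rabs (RInt g a (s / 2)
                - Rpower (2 * t * s) (- mu)
                  * (Gamma mu * cos (mu * PI / 2 + ph)))
          <= 5 * (Rpower (W (s / 2)) (mu - 1) / (2 * t * s))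
             + (2 + 1 / mu) * Rpower (W a) mu) in G.
  assert (Egf : forall q, a <= q <= s / 2 ->
     g q = Rpower q (mu - 1) * b q * cos (t * (q - s) ^ 2 + th)).
  { intros q Hq. unfold g, scal; simpl; unfold mult; simpl. as_R.
    assert (Bq := endpoint_base_bounds s q (proj1 Hs) ltac:(lra)).
    replace (2 * t * s * W q + ph) with (- (t * (q * 1 - s) ^ 2 + th))
      by (unfold W, ph; field; lra).
    rewrite cos_neg, Rmult_1_r, Wpos by lra.
    rewrite <- Rpower_mult_distr by lra. unfold b, endpoint_factor. simpl. ring. }
  assert (Ef : ex_RInt f a (s / 2)).
  { apply ex_RInt_cont; [lra | ]. intros q Hq.
    apply (continuous_mult k (fun q => cos (t * (q - s) ^ 2 + th))).
    - apply (ex_derive_continuous (V := R_NormedModule)).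
      eexists. apply X1, Hq.
    - apply (ex_derive_continuous (V := R_NormedModule)). auto_derive. trivial. }
  assert (Eg : ex_RInt g a (s / 2)).
  { apply (ex_RInt_ext
       (fun q => Rpower q (mu - 1) * b q * cos (t * (q - s) ^ 2 + th))).
    { rewrite Rmin_left, Rmax_right by lra. intros q Hq. symmetry. apply Egf. lra. }
    apply ex_RInt_cont; [lra | ]. intros q Hq.
    apply (continuous_mult (fun q => Rpower q (mu - 1) * b q)
             (fun q => cos (t * (q - s) ^ 2 + th))).
    - apply (continuous_mult (fun q => Rpower q (mu - 1)) b).
      + apply continuous_Rpower; lra.
      + apply (ex_derive_continuous (V := R_NormedModule)).
        eexists. apply Db. lra.
    - apply (ex_derive_continuous (V := R_NormedModule)). auto_derive. trivial. }
  assert (S : RInt (fun q => Rpower q (mu - 1) * v q * cos (t * (q - s) ^ 2 + th))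
                a (s / 2)
              = RInt f a (s / 2) + v 0 * RInt g a (s / 2)).
  { rewrite <- RInt_scal_R by exact Eg.
    rewrite (RInt_ext _ (fun q => plus (f q) (v 0 * g q))).
    - apply (RInt_plus (V := R_CompleteNormedModule)); [exact Ef | ].
      apply (ex_RInt_scal (V := R_NormedModule)), Eg.
    - rewrite Rmin_left, Rmax_right by lra. intros q Hq.
      rewrite Egf by lra. unfold f, k, A, plus; simpl. as_R. ring. }
  rewrite S.
  set (I := RInt f a (s / 2)) in *. set (J := RInt g a (s / 2)) in *.
  set (c := Rpower (2 * t * s) (- mu) * (Gamma mu * cos (mu * PI / 2 + ph))) in *.
  replace (I + v 0 * J - c * v 0) with (I + v 0 * (J - c)) by ring.
  eapply Rle_trans; [apply Rabs_triang | ]. rewrite Rabs_mult.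
  (* At the cut [W] equals [3 s / 8], and [(3/8)^(mu-1) <= 8/3] gives the factor [4/3]. Multiplied
     by the [5] of the Gamma approximation it stays below [7]. *)
  assert (T1 : Rpower (W (s / 2)) (mu - 1) / (2 * t * s)
               <= 4 / 3 * (Rpower s mu / (t * s ^ 2))).
  { rewrite Ws, <- Rpower_mult_distr, (Rpower_minus_one s) by lra.
    assert (R1 : Rpower (3 / 8) (mu - 1) <= / (3 / 8))
      by (apply Rpower_le_inv; lra).
    replace (4 / 3 * (Rpower s mu / (t * s ^ 2)))
      with (/ (3 / 8) * (Rpower s mu / s) / (2 * t * s)) by (field; lra).
    apply Rmult_le_compat_r.
    - left. apply Rinv_0_lt_compat, Rmult_lt_0_compat; lra.
    - apply Rmult_le_compat_r; [ | exact R1].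
      left. apply Rdiv_lt_0_compat; [apply Rpower_pos | lra]. }
  assert (T2 : Rpower (W a) mu <= Rpower a mu) by (apply Rle_Rpower_l; lra).
  set (e := Rpower s mu / (t * s ^ 2)) in *.
  assert (He : 0 < e).
  { apply Rdiv_lt_0_compat; [apply Rpower_pos | ].
    apply Rmult_lt_0_compat; [lra | apply pow_lt; lra]. }
  assert (Hm : 0 < 1 / mu) by (apply Rdiv_lt_0_compat; lra).
  assert (T3 : Rabs (J - c) <= 7 * e + (2 + 1 / mu) * Rpower a mu).
  { assert ((2 + 1 / mu) * Rpower (W a) mu <= (2 + 1 / mu) * Rpower a mu)
      by (apply Rmult_le_compat_l; lra).
    lra. }
  assert (T4 : Rabs (v 0) * Rabs (J - c)
               <= M0 * (7 * e + (2 + 1 / mu) * Rpower a mu))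
    by (apply Rmult_le_compat; try assumption; apply Rabs_pos).
  lra.
Qed.

(** * The interior contribution and the full expansion *)

(** The interval is split at the stationary point [s], and each side is a half-line problem
    contributing half of the leading term. The boundary term at [L] is killed by [v L = 0]; the one
    at [s/2] gives the [10 * M0] term. *)
Lemma interior_expansion (mu delta L M0 M1 t s th : R) (v dv : R -> R) :
  0 < mu < 1 -> 1 / 2 < delta < 1 -> 0 < t -> 0 < s <= 1 -> s < L ->
  (forall q, is_derive v q (dv q)) -> (forall q, continuous dv q) ->
  v L = 0 ->
  (forall q, 0 <= q <= L -> Rabs (v q) <= M0) ->
  (forall q, 0 <= q <= L -> Rabs (dv q) <= M1) ->
  Rabs (RInt (fun q => Rpower q (mu - 1) * v q * cos (t * (q - s) ^ 2 + th))
          (s / 2) L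
        - sqrt PI * (Rpower t (- (1 / 2)) * cos (PI / 4 + th))
          * (Rpower s (mu - 1) * v s))
  <= 10 * M0 * (Rpower s mu / s ^ 2 / t)
     + 3 * (4 * M0 + 2 * M1) / (2 - 2 * delta) * (Rpower L (2 - 2 * delta) + 1)
       * (Rpower s mu / s ^ 2 * Rpower t (- delta)).
Proof.
  intros Hmu Hd Ht Hs HsL Dv Cdv HvL HM0 HM1.
  set (f := fun q => Rpower q (mu - 1) * v q).
  set (f' := fun q => (mu - 1) * Rpower q (mu - 1 - 1) * v q
                      + Rpower q (mu - 1) * dv q).
  set (e := Rpower s mu / s ^ 2).
  assert (Ps := Rpower_pos s mu).
  assert (He : 0 < e) by (apply Rdiv_lt_0_compat; [exact Ps | nra]).
  (* For [q >= s/2] one has [q^(mu-1) <= 2 s^(mu-1)] and [1/q <= 2/s], whence [4] for the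
     differentiated weight and [2] for [dv]. The latter uses [s^(mu-1) <= e], that is [s <= 1]. *)
  set (M := (4 * M0 + 2 * M1) * e).
  assert (M0p : 0 <= M0) by (specialize (HM0 s ltac:(lra));
                             pose proof (Rabs_pos (v s)); lra).
  assert (M1p : 0 <= M1) by (specialize (HM1 s ltac:(lra));
                             pose proof (Rabs_pos (dv s)); lra).
  assert (Cv : forall q, continuous v q).
  { intros q. apply (ex_derive_continuous (V := R_NormedModule)).
    eexists. apply Dv. }
  assert (Df : forall q, 0 < q -> is_derive f q (f' q)).
  { intros q Hq. apply (is_derive_mult (fun q => Rpower q (mu - 1)) v);
      [apply is_derive_Rpower, Hq | apply Dv | intros; apply Rmult_comm]. }
  assert (Cf' : forall q, 0 < q -> continuous f' q).
  { intros q Hq. unfold f'. apply (continuous_plus (V := R_NormedModule)).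
    - apply (continuous_mult (fun q => (mu - 1) * Rpower q (mu - 1 - 1)) v).
      + apply (ex_derive_continuous (V := R_NormedModule)).
        auto_derive. apply ex_derive_Rpower, Hq.
      + apply Cv.
    - apply (continuous_mult (fun q => Rpower q (mu - 1)) dv).
      + apply continuous_Rpower, Hq.
      + apply Cdv. }
  assert (Bp : forall q, s / 2 <= q -> Rpower q (mu - 1) <= 2 * (Rpower s mu / s)).
  { intros q Hq. apply Rle_trans with (Rpower (s / 2) (mu - 1)).
    - apply Rpower_le_antitone; lra.
    - rewrite Rpower_minus_one by lra.
      replace (2 * (Rpower s mu / s)) with (Rpower s mu / (s / 2)) by (field; lra).
      apply Rmult_le_compat_r; [left; apply Rinv_0_lt_compat; lra | ].
      apply Rle_Rpower_l; lra. }
  assert (Be : Rpower s mu / s <= e).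
  { unfold e. apply Rmult_le_compat_l; [lra | ].
    apply Rinv_le_contravar; nra. }
  assert (Bf' : forall q, s / 2 <= q <= L -> Rabs (f' q) <= M).
  { intros q Hq. unfold f'.
    assert (P := Rpower_pos q (mu - 1)).
    specialize (Bp q (proj1 Hq)).
    specialize (HM0 q ltac:(lra)). specialize (HM1 q ltac:(lra)).
    eapply Rle_trans; [apply Rabs_triang | ].
    rewrite (Rpower_minus_one q (mu - 1)) by lra.
    rewrite !Rabs_mult, (Rabs_pos_eq (Rpower q (mu - 1))) by lra.
    rewrite (Rabs_pos_eq (Rpower q (mu - 1) / q))
      by (left; apply Rdiv_lt_0_compat; lra).
    assert (Rabs (mu - 1) <= 1) by (apply Rabs_le; lra).
    assert (I : / q <= 2 / s).
    { replace (2 / s) with (/ (s / 2)) by (field; lra).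
      apply Rinv_le_contravar; lra. }
    assert (Iq : 0 < / q) by (apply Rinv_0_lt_compat; lra).
    assert (Q0 : Rpower q (mu - 1) / q <= 4 * e).
    { replace (4 * e) with (2 * (Rpower s mu / s) * (2 / s))
        by (unfold e; field; lra).
      apply Rmult_le_compat; lra. }
    assert (Q1 : Rabs (mu - 1) * (Rpower q (mu - 1) / q) * Rabs (v q)
                 <= 1 * (4 * e) * M0).
    { assert (0 <= Rpower q (mu - 1) / q)
        by (left; apply Rdiv_lt_0_compat; lra).
      apply Rmult_le_compat; [ | apply Rabs_pos | | exact HM0].
      - apply Rmult_le_pos; [apply Rabs_pos | assumption].
      - apply Rmult_le_compat; try assumption. apply Rabs_pos. }
    assert (Q2 : Rpower q (mu - 1) * Rabs (dv q) <= 2 * e * M1).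
    { apply Rmult_le_compat; [lra | apply Rabs_pos | lra | exact HM1]. }
    unfold M. lra. }
  set (ch := fun q => cos (t * (q - s) ^ 2 + th)).
  assert (Cch : forall q, continuous ch q).
  { intros q. apply (ex_derive_continuous (V := R_NormedModule)).
    unfold ch. auto_derive. trivial. }
  assert (Cf : forall q, 0 < q -> continuous f q).
  { intros q Hq. apply (ex_derive_continuous (V := R_NormedModule)).
    eexists. apply Df, Hq. }
  assert (Ex : forall x y, 0 < x -> x <= y -> ex_RInt (fun q => f q * ch q) x y).
  { intros x y Hx Hxy. apply ex_RInt_cont; [exact Hxy | ]. intros q Hq.
    apply (continuous_mult f ch); [apply Cf; lra | apply Cch]. }
  change (Rabs (RInt (fun q => f q * ch q) (s / 2) L
                - sqrt PI * (Rpower t (- (1 / 2)) * cos (PI / 4 + th)) * f s)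
          <= 10 * M0 * (e / t)
             + 3 * (4 * M0 + 2 * M1) / (2 - 2 * delta)
               * (Rpower L (2 - 2 * delta) + 1) * (e * Rpower t (- delta))).
  rewrite (RInt_split _ (s / 2) s L) by (apply Ex; lra).
  assert (IR : RInt (fun q => f q * ch q) s L
               = RInt (fun r => f (s + r) * cos (t * r ^ 2 + th)) 0 (L - s)).
  { assert (C := RInt_comp_lin (V := R_CompleteNormedModule)
                   (fun q => f q * ch q) 1 s 0 (L - s)).
    replace (1 * 0 + s) with s in C by ring.
    replace (1 * (L - s) + s) with L in C by ring.
    rewrite <- C by (apply Ex; lra).
    apply RInt_ext. intros r _. unfold scal; simpl; unfold mult; simpl. as_R.
    unfold ch. replace (1 * r + s) with (s + r) by ring.
    replace (s + r - s) with r by ring. simpl. ring. }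
  assert (IL : RInt (fun q => f q * ch q) (s / 2) s
               = RInt (fun r => f (s - r) * cos (t * r ^ 2 + th)) 0 (s / 2)).
  { assert (C := RInt_comp_lin (V := R_CompleteNormedModule)
                   (fun q => f q * ch q) (-1) s 0 (s / 2)).
    replace (-1 * 0 + s) with s in C by ring.
    replace (-1 * (s / 2) + s) with (s / 2) in C by field.
    (* The reflection reverses the orientation, and this sign cancels the factor [-1] of the
       substitution. *)
    rewrite <- opp_RInt_swap by (apply ex_RInt_swap, Ex; lra).
    rewrite <- C by (apply ex_RInt_swap, Ex; lra).
    rewrite <- (RInt_opp (V := R_CompleteNormedModule)).
    - apply RInt_ext. intros r _. unfold opp, scal; simpl; unfold mult; simpl.
      as_R. unfold ch. replace (-1 * r + s) with (s - r) by ring.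
      replace (s - r - s) with (- r) by ring.
      replace ((- r) ^ 2) with (r ^ 2) by ring. simpl. ring.
    - apply (ex_RInt_comp_lin (V := R_NormedModule)
               (fun q => f q * ch q) (-1) s 0 (s / 2)).
      replace (-1 * 0 + s) with s by ring.
      replace (-1 * (s / 2) + s) with (s / 2) by field.
      apply ex_RInt_swap, Ex; lra. }
  rewrite IR, IL.
  assert (HR := stationary_phase_half_line delta t th (L - s) M
                  (fun r => f (s + r)) (fun r => f' (s + r)) Hd Ht ltac:(lra)).
  match type of HR with ?A -> ?B -> ?C -> _ =>
    assert (X1 : A); [ | assert (X2 : B); [ | assert (X3 : C);
      [ | specialize (HR X1 X2 X3); clear X1 X2 X3]]] end.
  { intros r Hr.
    replace (f' (s + r)) with (scal 1 (f' (s + r)))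
      by (unfold scal; simpl; unfold mult; simpl; as_R; ring).
    apply (is_derive_comp f (fun r => s + r)).
    - apply Df. lra.
    - auto_derive; [trivial | ring]. }
  { intros r Hr. apply (continuous_comp (fun r => s + r) f').
    - apply (ex_derive_continuous (V := R_NormedModule)). auto_derive. trivial.
    - apply Cf'. lra. }
  { intros r Hr. apply Bf'. lra. }
  assert (HL := stationary_phase_half_line delta t th (s / 2) M
                  (fun r => f (s - r)) (fun r => - f' (s - r)) Hd Ht ltac:(lra)).
  match type of HL with ?A -> ?B -> ?C -> _ =>
    assert (X1 : A); [ | assert (X2 : B); [ | assert (X3 : C);
      [ | specialize (HL X1 X2 X3); clear X1 X2 X3]]] end.
  { intros r Hr.
    replace (- f' (s - r)) with (scal (- (1)) (f' (s - r)))
      by (unfold scal; simpl; unfold mult; simpl; as_R; ring).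
    apply (is_derive_comp f (fun r => s - r)).
    - apply Df. lra.
    - auto_derive; [trivial | ring]. }
  { intros r Hr. apply (continuous_opp (V := R_NormedModule)).
    apply (continuous_comp (fun r => s - r) f').
    - apply (ex_derive_continuous (V := R_NormedModule)). auto_derive. trivial.
    - apply Cf'. lra. }
  { intros r Hr. rewrite Rabs_Ropp. apply Bf'. lra. }
  cbv beta in HR, HL. rewrite Rplus_0_r in HR. rewrite Rminus_0_r in HL.
  replace (s + (L - s)) with L in HR by ring.
  replace (f L) with 0 in HR by (unfold f; rewrite HvL; ring).
  rewrite Rabs_R0, Rmult_0_r, Rplus_0_l in HR.
  replace (s - s / 2) with (s / 2) in HL by field.
  set (JR := RInt (fun r => f (s + r) * cos (t * r ^ 2 + th)) 0 (L - s)) in *.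
  set (JL := RInt (fun r => f (s - r) * cos (t * r ^ 2 + th)) 0 (s / 2)) in *.
  set (c := sqrt PI / 2 * (Rpower t (- (1 / 2)) * cos (PI / 4 + th)) * f s) in *.
  replace (JL + JR - sqrt PI * (Rpower t (- (1 / 2)) * cos (PI / 4 + th)) * f s)
    with ((JL - c) + (JR - c)) by (unfold c; field).
  eapply Rle_trans; [apply Rabs_triang | ].
  assert (Pt := Rpower_pos t (- delta)).
  assert (PL : Rpower (L - s) (2 - 2 * delta) <= Rpower L (2 - 2 * delta))
    by (apply Rle_Rpower_l; lra).
  assert (PS : Rpower (s / 2) (2 - 2 * delta) <= 1)
    by (apply Rpower_le_one; lra).
  assert (Bs : 5 / 2 / (t * (s / 2)) * Rabs (f (s / 2)) <= 10 * M0 * (e / t)).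
  { replace (10 * M0 * (e / t))
      with (5 / 2 / (t * (s / 2)) * (2 * (Rpower s mu / s) * M0))
      by (unfold e; field; lra).
    apply Rmult_le_compat_l.
    - left. apply Rdiv_lt_0_compat; [lra | nra].
    - unfold f. rewrite Rabs_mult.
      rewrite (Rabs_pos_eq (Rpower _ _)) by (left; apply Rpower_pos).
      apply Rmult_le_compat; [left; apply Rpower_pos | apply Rabs_pos | | ].
      + apply Bp; lra.
      + apply HM0; lra. }
  assert (Kp : 0 <= 3 * M / (2 - 2 * delta)).
  { apply Rmult_le_pos; [ | left; apply Rinv_0_lt_compat; lra].
    unfold M. apply Rmult_le_pos; [lra | apply Rmult_le_pos; lra]. }
  replace (3 * (4 * M0 + 2 * M1) / (2 - 2 * delta)
           * (Rpower L (2 - 2 * delta) + 1) * (e * Rpower t (- delta)))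
    with (3 * M / (2 - 2 * delta) * (Rpower t (- delta) * Rpower L (2 - 2 * delta))
          + 3 * M / (2 - 2 * delta) * (Rpower t (- delta) * 1))
    by (unfold M; field; lra).
  assert (TL : 3 * M / (2 - 2 * delta)
               * (Rpower t (- delta) * Rpower (L - s) (2 - 2 * delta))
          <= 3 * M / (2 - 2 * delta)
             * (Rpower t (- delta) * Rpower L (2 - 2 * delta)))
    by (apply Rmult_le_compat_l; [exact Kp | apply Rmult_le_compat_l; lra]).
  assert (TS : 3 * M / (2 - 2 * delta)
               * (Rpower t (- delta) * Rpower (s / 2) (2 - 2 * delta))
          <= 3 * M / (2 - 2 * delta) * (Rpower t (- delta) * 1))
    by (apply Rmult_le_compat_l; [exact Kp | apply Rmult_le_compat_l; lra]).
  lra.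
Qed.

Lemma continuous_bounded (f : R -> R) (a b : R) :
  (forall x, continuous f x) ->
  exists M, 0 <= M /\ forall x, a <= x <= b -> Rabs (f x) <= M.
Proof.
  intros Hf.
  destruct (bounded_continuity (V := R_NormedModule) f a b) as [M HM].
  - intros x _. apply Hf.
  - exists (Rmax 0 M). split; [apply Rmax_l | ].
    intros x Hx. left. apply Rlt_le_trans with (1 := HM x Hx), Rmax_r.
Qed.

Definition osc_integrand (mu : R) (v : R -> R) (t s th q : R) : R :=
  Rpower q (mu - 1) * v q * cos (t * (q - s) ^ 2 + th).

(** The first summand is the contribution of the endpoint [0], the source of the [K_mu] term; the
    second is that of the stationary point, the source of the [H] term. *)
Definition osc_leading (mu : R) (v : R -> R) (t s th : R) : R :=
  Rpower (2 * t * s) (- mu)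
  * (Gamma mu * cos (mu * PI / 2 + (- (t * s ^ 2) - th))) * v 0
  + sqrt PI * (Rpower t (- (1 / 2)) * cos (PI / 4 + th))
    * (Rpower s (mu - 1) * v s).

(** Only the end [0] is singular. On [[L/2, L]] the integrand is bounded by the constant [K], so the
    error at [L] is linear and vanishes once the truncation reaches [L]. *)
Lemma osc_integral_exists (mu L M t s th : R) (v : R -> R) :
  0 < mu < 1 -> 0 < L -> (forall q, continuous v q) ->
  (forall q, 0 <= q <= L -> Rabs (v q) <= M) ->
  exists l, is_RInt_gen (osc_integrand mu v t s th) (at_right 0) (at_left L) l /\
    forall a, 0 < a <= L ->
      Rabs (l - RInt (osc_integrand mu v t s th) a L) <= M / mu * Rpower a mu.
Proof.
  intros Hmu HL Cv HM.
  set (f := osc_integrand mu v t s th).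
  assert (Mp : 0 <= M) by (specialize (HM L ltac:(lra));
                           pose proof (Rabs_pos (v L)); lra).
  assert (Bf : forall q, 0 < q <= L -> Rabs (f q) <= M * Rpower q (mu - 1)).
  { intros q Hq. unfold f, osc_integrand. specialize (HM q ltac:(lra)).
    assert (P := Rpower_pos q (mu - 1)).
    rewrite !Rabs_mult, (Rabs_pos_eq (Rpower q _)) by lra.
    assert (C : Rabs (cos (t * (q - s) ^ 2 + th)) <= 1)
      by (apply Rabs_le, COS_bound).
    replace (M * Rpower q (mu - 1)) with (Rpower q (mu - 1) * M * 1) by ring.
    apply Rmult_le_compat; [ | apply Rabs_pos | | exact C].
    - apply Rmult_le_pos; [lra | apply Rabs_pos].
    - apply Rmult_le_compat_l; lra. }
  assert (Ex : forall x y, 0 < x -> 0 < y -> ex_RInt f x y).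
  { intros x y Hx Hy. apply (ex_RInt_continuous (V := R_CompleteNormedModule)).
    intros q Hq.
    assert (0 < Rmin x y) by (apply Rmin_glb_lt; lra).
    apply (continuous_mult (fun q => Rpower q (mu - 1) * v q)
             (fun q => cos (t * (q - s) ^ 2 + th))).
    - apply (continuous_mult (fun q => Rpower q (mu - 1)) v).
      + apply continuous_Rpower. lra.
      + apply Cv.
    - apply (ex_derive_continuous (V := R_NormedModule)). auto_derive. trivial. }
  assert (Sw : forall x y, 0 < x -> 0 < y -> Rabs (RInt f x y) = Rabs (RInt f y x)).
  { intros x y Hx Hy. rewrite <- opp_RInt_swap by (apply Ex; assumption).
    unfold opp; simpl. apply Rabs_Ropp. }
  set (K := M * Rpower (L / 2) (mu - 1)).
  assert (KM : 0 < M / mu \/ M / mu = 0).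
  { assert (0 <= M / mu); [ | lra].
    apply Rmult_le_pos; [lra | left; apply Rinv_0_lt_compat; lra]. }
  destruct (improper_RInt (at_right 0) (at_left L) _ _ f
              (fun x => M / mu * Rpower x mu) (fun x => K * (L - x))
              (fun x => 0 < x <= L) (fun x => L / 2 <= x <= L))
    as [l [Hl Hb]].
  - exists (mkposreal L HL). intros x Hx Hx0.
    change (Rabs (x - 0) < L) in Hx. rewrite Rminus_0_r, Rabs_pos_eq in Hx; lra.
  - assert (HL2 : 0 < L / 2) by lra.
    exists (mkposreal _ HL2). intros x Hx Hx0.
    change (Rabs (x - L) < L / 2) in Hx. apply Rabs_lt_between in Hx. lra.
  - intros x y Hx Hy. apply Ex; lra.
  - assert (O : forall x y, 0 < x -> x <= y -> y <= L ->
              Rabs (RInt f x y) <= M / mu * Rpower x mu + M / mu * Rpower y mu).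
    { intros x y Hx Hxy Hy.
      assert (B := RInt_power_weight_le mu M f x y (proj1 Hmu) ltac:(lra)
                     (Ex x y Hx ltac:(lra))).
      specialize (B ltac:(intros; apply Bf; lra)).
      pose proof (Rpower_pos x mu).
      assert (0 <= M / mu * Rpower x mu) by (apply Rmult_le_pos; lra).
      lra. }
    intros x y Hx Hy. destruct (Rle_dec x y).
    + apply O; lra.
    + rewrite Sw, Rplus_comm by lra. apply O; lra.
  - assert (O : forall x y, L / 2 <= x -> x <= y -> y <= L ->
              Rabs (RInt f x y) <= K * (L - x) + K * (L - y)).
    { intros x y Hx Hxy Hy.
      assert (0 <= K) by (apply Rmult_le_pos; [lra | left; apply Rpower_pos]).
      assert (B : Rabs (RInt f x y) <= (y - x) * K).
      { apply abs_RInt_le_const; [lra | apply Ex; lra | ]. intros q Hq.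
        apply Rle_trans with (M * Rpower q (mu - 1)); [apply Bf; lra | ].
        apply Rmult_le_compat_l; [lra | ].
        apply Rpower_le_antitone; lra. }
      nra. }
    intros x y Hx Hy. destruct (Rle_dec x y).
    + apply O; lra.
    + rewrite Sw, Rplus_comm by lra. apply O; lra.
  - apply filterlim_Rpower_at_right_0. lra.
  - apply (filterlim_filter_le_1 (F := locally L));
      [apply filter_le_within | ].
    replace 0 with (K * (L - L)) by ring.
    apply (ex_derive_continuous (V := R_NormedModule) (fun x => K * (L - x))).
    auto_derive. trivial.
  - exists l. split; [exact Hl | ]. intros a Ha.
    apply Rle_trans with (1 := Hb a L Ha ltac:(lra)). right. ring.
Qed.

Lemma osc_integral_expansion (mu delta L : R) (v dv : R -> R) :
  0 < mu < 1 -> 1 / 2 < delta < 1 -> 0 < L ->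
  (forall q, is_derive v q (dv q)) -> (forall q, continuous dv q) ->
  v L = 0 ->
  exists C, 0 <= C /\
    forall t s th, exists l,
    is_RInt_gen (osc_integrand mu v t s th) (at_right 0) (at_left L) l /\
    Rabs l <= C /\
    (1 <= t -> 0 < s <= 1 -> s < L ->
     Rabs (l - osc_leading mu v t s th)
     <= C * (Rpower s (mu - 2) * Rpower t (- delta))).
Proof.
  intros Hmu Hd HL Dv Cdv HvL.
  assert (Cv : forall q, continuous v q).
  { intros q. apply (ex_derive_continuous (V := R_NormedModule)).
    eexists. apply Dv. }
  destruct (continuous_bounded v 0 L Cv) as [M0 [M0p HM0]].
  destruct (continuous_bounded dv 0 L Cdv) as [M1 [M1p HM1]].
  assert (Im : 0 < / mu) by (apply Rinv_0_lt_compat; lra).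
  set (K1 := 2 * (M1 + 3 * M0) * (2 + 2 / mu) + 7 * M0).
  set (K2 := 3 * (4 * M0 + 2 * M1) / (2 - 2 * delta)
             * (Rpower L (2 - 2 * delta) + 1)).
  set (K3 := 2 * (M0 / mu) * Rpower L mu).
  assert (K1p : 0 <= K1).
  { unfold K1, Rdiv.
    assert (0 <= 2 * (M1 + 3 * M0) * (2 + 2 * / mu))
      by (apply Rmult_le_pos; lra). lra. }
  assert (K2p : 0 <= K2).
  { unfold K2. pose proof (Rpower_pos L (2 - 2 * delta)).
    apply Rmult_le_pos; [ | lra].
    apply Rmult_le_pos; [lra | left; apply Rinv_0_lt_compat; lra]. }
  assert (K3p : 0 <= K3).
  { unfold K3, Rdiv. pose proof (Rpower_pos L mu).
    repeat apply Rmult_le_pos; lra. }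
  exists (K1 + (10 * M0 + K2) + K3). split; [lra | ].
  intros t s th.
  destruct (osc_integral_exists mu L M0 t s th v Hmu HL Cv HM0) as [l [Hl Hb]].
  exists l. split; [exact Hl | ].
  assert (Ex : forall x y, 0 < x -> x <= y ->
            ex_RInt (osc_integrand mu v t s th) x y).
  { intros x y Hx Hxy. apply ex_RInt_cont; [exact Hxy | ]. intros q Hq.
    apply (continuous_mult (fun q => Rpower q (mu - 1) * v q)
             (fun q => cos (t * (q - s) ^ 2 + th))).
    - apply (continuous_mult (fun q => Rpower q (mu - 1)) v).
      + apply continuous_Rpower. lra.
      + apply Cv.
    - apply (ex_derive_continuous (V := R_NormedModule)). auto_derive. trivial. }
  split.
  - specialize (Hb L ltac:(lra)).
    rewrite (RInt_point (V := R_CompleteNormedModule)) in Hb.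
    change (Rabs (l - 0) <= M0 / mu * Rpower L mu) in Hb.
    rewrite Rminus_0_r in Hb.
    assert (0 <= M0 / mu * Rpower L mu).
    { unfold Rdiv. pose proof (Rpower_pos L mu).
      repeat apply Rmult_le_pos; lra. }
    unfold K3. lra.
  - intros Ht Hs HsL.
    assert (E : Rpower s (mu - 2) = Rpower s mu / s ^ 2).
    { unfold Rminus. rewrite Rpower_plus, Rpower_Ropp. change 2 with (INR 2) at 1.
      rewrite Rpower_pow by lra. reflexivity. }
    rewrite E. set (e := Rpower s mu / s ^ 2).
    assert (He : 0 < e) by (apply Rdiv_lt_0_compat; [apply Rpower_pos | nra]).
    assert (It : / t <= Rpower t (- delta)).
    { rewrite <- (Rpower_1 t) at 1 by lra. rewrite <- Rpower_Ropp.
      apply Rle_Rpower; lra. }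
    assert (Pt := Rpower_pos t (- delta)).
    (* The multiple of [a^mu] collects the truncation of the improper integral, [M0 / mu], and the
       cut-off error of the endpoint expansion. *)
    apply (le_of_le_power _ _ (M0 / mu + M0 * (2 + 1 / mu)) mu (s / 2));
      [lra | lra | ].
    intros a Ha.
    assert (B1 := endpoint_expansion mu M0 M1 t s th a v dv Hmu ltac:(lra) Hs
                    ltac:(lra) Dv Cdv (HM0 0 ltac:(lra))
                    ltac:(intros; apply HM1; lra)).
    assert (B2 := interior_expansion mu delta L M0 M1 t s th v dv Hmu Hd
                    ltac:(lra) Hs HsL Dv Cdv HvL HM0 HM1).
    specialize (Hb a ltac:(lra)).
    rewrite (RInt_split _ a (s / 2) L) in Hb by (apply Ex; lra).
    change (RInt (fun q => Rpower q (mu - 1) * v q * cos (t * (q - s) ^ 2 + th))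
              a (s / 2))
      with (RInt (osc_integrand mu v t s th) a (s / 2)) in B1.
    change (RInt (fun q => Rpower q (mu - 1) * v q * cos (t * (q - s) ^ 2 + th))
              (s / 2) L)
      with (RInt (osc_integrand mu v t s th) (s / 2) L) in B2.
    unfold osc_leading.
    set (I1 := RInt (osc_integrand mu v t s th) a (s / 2)) in *.
    set (I2 := RInt (osc_integrand mu v t s th) (s / 2) L) in *.
    match goal with |- Rabs (l - (?x + ?y)) <= _ =>
      set (m1 := x) in *; set (m2 := y) in * end.
    replace (l - (m1 + m2)) with ((l - (I1 + I2)) + ((I1 - m1) + (I2 - m2))) by ring.
    eapply Rle_trans; [apply Rabs_triang | ].
    eapply Rle_trans; [apply Rplus_le_compat_l, Rabs_triang | ].
    replace (Rpower s mu / (t * s ^ 2)) with (e / t) in B1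
      by (unfold e; field; lra).
    fold e K1 in B1. fold e K2 in B2.
    assert (Et : e / t <= e * Rpower t (- delta))
      by (apply Rmult_le_compat_l; lra).
    set (E2 := e * Rpower t (- delta)) in *.
    assert (0 <= E2) by (apply Rmult_le_pos; lra).
    assert (K1 * (e / t) <= K1 * E2) by (apply Rmult_le_compat_l; lra).
    assert (10 * M0 * (e / t) <= 10 * M0 * E2) by (apply Rmult_le_compat_l; lra).
    assert (0 <= K3 * E2) by (apply Rmult_le_pos; lra).
    lra.
Qed.

(** * From complex to real integrals *)

Definition clamp (a b x : R) : R := Rmax a (Rmin b x).

Lemma clamp_in (a b x : R) : a <= b -> a <= clamp a b x <= b.
Proof.
  intros Hab. unfold clamp. split; [apply Rmax_l | ].
  apply Rmax_lub; [exact Hab | apply Rmin_l].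
Qed.

Lemma clamp_id (a b x : R) : a <= x <= b -> clamp a b x = x.
Proof.
  intros Hx. unfold clamp. rewrite Rmin_right, Rmax_right; lra.
Qed.

Lemma clamp_lipschitz (a b x y : R) :
  Rabs (clamp a b x - clamp a b y) <= Rabs (x - y).
Proof.
  unfold clamp, Rmax, Rmin.
  repeat destruct Rle_dec; unfold Rabs; repeat destruct Rcase_abs; lra.
Qed.

(** Only points [q] of [[a, b]] are compared, so the derivative is one-sided at the ends. *)
Definition eps_derive_on (a b : R) (g dg : R -> R) : Prop :=
  forall p, a <= p <= b -> forall e, 0 < e -> exists d, 0 < d /\
    forall q, a <= q <= b -> 0 < Rabs (q - p) < d ->
      Rabs ((g q - g p) / (q - p) - dg p) < e.

Definition eps_continuous_on (a b : R) (g : R -> R) : Prop :=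
  forall p, a <= p <= b -> forall e, 0 < e -> exists d, 0 < d /\
    forall q, a <= q <= b -> Rabs (q - p) < d -> Rabs (g q - g p) < e.

Lemma eps_derive_continuous (a b : R) (g dg : R -> R) :
  eps_derive_on a b g dg -> eps_continuous_on a b g.
Proof.
  intros D p Hp e He.
  destruct (D p Hp 1 Rlt_0_1) as [d [Hd H]].
  assert (Hm := Rabs_pos (dg p)).
  assert (Hr : 0 < e / (Rabs (dg p) + 1)) by (apply Rdiv_lt_0_compat; lra).
  exists (Rmin d (e / (Rabs (dg p) + 1))).
  split; [apply Rmin_glb_lt; lra | ]. intros q Hq Hqp.
  destruct (Req_dec q p) as [->|N].
  { rewrite Rminus_diag, Rabs_R0. exact He. }
  assert (P : 0 < Rabs (q - p)) by (apply Rabs_pos_lt; lra).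
  specialize (H q Hq).
  assert (H1 : Rabs (q - p) < d)
    by (apply Rlt_le_trans with (1 := Hqp), Rmin_l).
  assert (H2 : Rabs (q - p) < e / (Rabs (dg p) + 1))
    by (apply Rlt_le_trans with (1 := Hqp), Rmin_r).
  specialize (H (conj P H1)).
  replace (g q - g p) with ((g q - g p) / (q - p) * (q - p)) by (field; lra).
  rewrite Rabs_mult.
  assert (B : Rabs ((g q - g p) / (q - p)) <= Rabs (dg p) + 1).
  { replace ((g q - g p) / (q - p))
      with (dg p + ((g q - g p) / (q - p) - dg p)) by ring.
    eapply Rle_trans; [apply Rabs_triang | ]. lra. }
  apply Rle_lt_trans with ((Rabs (dg p) + 1) * Rabs (q - p)).
  - apply Rmult_le_compat_r; lra.
  - replace e with ((Rabs (dg p) + 1) * (e / (Rabs (dg p) + 1))) by (field; lra).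
    apply Rmult_lt_compat_l; lra.
Qed.

Lemma continuous_clamp (a b : R) (g : R -> R) (x : R) :
  a <= b -> eps_continuous_on a b g -> continuous (fun y => g (clamp a b y)) x.
Proof.
  intros Hab H. apply filterlim_locally. intros e.
  destruct (H (clamp a b x) (clamp_in a b x Hab) e (cond_pos e)) as [d [Hd Hg]].
  exists (mkposreal d Hd). intros y Hy.
  change (Rabs (y - x) < d) in Hy.
  change (Rabs (g (clamp a b y) - g (clamp a b x)) < e).
  apply Hg; [apply clamp_in, Hab | ].
  apply Rle_lt_trans with (2 := Hy), clamp_lipschitz.
Qed.

(** The derivative is extended by constants and then integrated; clamping [g] itself could create
    kinks at the ends. The extension lets all later calculus use two-sided derivatives. *)
Lemma C1_extension (a b : R) (g dg : R -> R) :
  a < b -> eps_derive_on a b g dg -> eps_continuous_on a b dg ->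
  exists v dv : R -> R,
    (forall x, is_derive v x (dv x)) /\ (forall x, continuous dv x) /\
    (forall x, a <= x <= b -> v x = g x).
Proof.
  intros Hab Dg Cdg.
  set (dv := fun x => dg (clamp a b x)).
  assert (Cdv : forall x, continuous dv x)
    by (intros; apply continuous_clamp; [lra | exact Cdg]).
  set (I := fun x => RInt dv a x).
  assert (DI : forall x, is_derive I x (dv x)).
  { intros x. apply (is_derive_RInt (V := R_NormedModule) dv I a); [ | apply Cdv].
    apply filter_forall. intros y.
    apply (RInt_correct (V := R_CompleteNormedModule)).
    apply (ex_RInt_continuous (V := R_CompleteNormedModule)). intros; apply Cdv. }
  exists (fun x => g a + I x), dv. split; [ | split; [exact Cdv | ]].
  { intros x. assert (D := DI x).
    assert (E : Derive (fun y : R => I y) x = dv x)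
      by apply is_derive_unique, D.
    auto_derive; [eexists; exact D | rewrite E; ring]. }
  intros x Hx.
  (* [h] is continuous up to the ends and has zero derivative inside, which is all that the mean
     value theorem asks for to make it constant on [[a, b]]. *)
  set (h := fun y => I y - g (clamp a b y)).
  assert (Ch : forall y, continuous h y).
  { intros y. apply (continuous_minus (V := R_NormedModule)).
    - apply (ex_derive_continuous (V := R_NormedModule) I).
      eexists; apply DI.
    - apply continuous_clamp; [lra | ].
      apply eps_derive_continuous with (1 := Dg). }
  assert (Dc : forall y, a < y < b ->
            is_derive (fun y => g (clamp a b y)) y (dv y)).
  { intros y Hy. apply is_derive_Reals. intros e He.
    destruct (Dg y ltac:(lra) e He) as [d [Hd H]].
    assert (Hm : 0 < Rmin d (Rmin (y - a) (b - y)))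
      by (repeat apply Rmin_glb_lt; lra).
    exists (mkposreal _ Hm). intros k Hk0 Hk. simpl in Hk.
    assert (K1 : Rabs k < d) by (apply Rlt_le_trans with (1 := Hk), Rmin_l).
    assert (K2 : Rabs k < Rmin (y - a) (b - y))
      by (apply Rlt_le_trans with (1 := Hk), Rmin_r).
    assert (K3 : Rabs k < y - a) by (apply Rlt_le_trans with (1 := K2), Rmin_l).
    assert (K4 : Rabs k < b - y) by (apply Rlt_le_trans with (1 := K2), Rmin_r).
    apply Rabs_lt_between in K3, K4.
    unfold dv. rewrite !clamp_id by lra.
    specialize (H (y + k) ltac:(lra)).
    replace (y + k - y) with k in H by ring.
    apply H. split; [apply Rabs_pos_lt, Hk0 | exact K1]. }
  assert (Z : h x = h a).
  { destruct (MVT_gen h a x (fun _ => 0)) as [c [_ Hc]].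
    - rewrite Rmin_left, Rmax_right by lra. intros y Hy.
      replace 0 with (minus (dv y) (dv y))
        by (unfold minus, plus, opp; simpl; as_R; ring).
      apply (is_derive_minus (V := R_NormedModule)); [apply DI | apply Dc; lra].
    - intros y _. apply continuity_pt_filterlim, Ch.
    - lra. }
  unfold h in Z. rewrite !clamp_id in Z by lra.
  unfold I at 2 in Z. rewrite (RInt_point (V := R_CompleteNormedModule)) in Z.
  unfold zero in Z; simpl in Z. lra.
Qed.

Lemma C1_on_extension (f : R -> C) (a b : R) :
  a < b -> C1_on f a b ->
  exists v1 dv1 v2 dv2 : R -> R,
    ((forall x, is_derive v1 x (dv1 x)) /\ (forall x, continuous dv1 x)) /\
    ((forall x, is_derive v2 x (dv2 x)) /\ (forall x, continuous dv2 x)) /\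
    (forall x, a <= x <= b -> f x = (v1 x, v2 x)).
Proof.
  intros Hab [df H].
  assert (D : forall p, a <= p <= b -> forall e, 0 < e -> exists d, 0 < d /\
     forall q, a <= q <= b -> 0 < Rabs (q - p) < d ->
     Rabs ((fst (f q) - fst (f p)) / (q - p) - fst (df p)) < e /\
     Rabs ((snd (f q) - snd (f p)) / (q - p) - snd (df p)) < e).
  { intros p Hp e He. destruct (H p Hp) as [H1 _].
    destruct (H1 _ (locally_ball (df p) (mkposreal e He))) as [d Hd].
    exists d. split; [apply cond_pos | ]. intros q Hq Hqp.
    assert (Hne : q - p <> 0)
      by (intros Z; rewrite Z, Rabs_R0 in Hqp; lra).
    destruct (Hd q) as [B1 B2].
    - change (Rabs (q - p) < d). lra.
    - intros Z. apply Hne. rewrite Z. apply Rminus_diag.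
    - exact Hq.
    - simpl in B1, B2.
      (* The complex quotient is unfolded through the inverse [(x - i y) / (x^2 + y^2)] with
         [y = 0]; [field] then reduces it to real quotients. *)
      change (Rabs ((fst (f q) + - fst (f p))
                    * ((q - p) / ((q - p) * ((q - p) * 1) + 0 * (0 * 1)))
                    - (snd (f q) + - snd (f p))
                      * (- 0 / ((q - p) * ((q - p) * 1) + 0 * (0 * 1)))
                    - fst (df p)) < e) in B1.
      change (Rabs ((fst (f q) + - fst (f p))
                    * (- 0 / ((q - p) * ((q - p) * 1) + 0 * (0 * 1)))
                    + (snd (f q) + - snd (f p))
                      * ((q - p) / ((q - p) * ((q - p) * 1) + 0 * (0 * 1)))
                    - snd (df p)) < e) in B2.
      split.
      + replace ((fst (f q) - fst (f p)) / (q - p)) with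
          ((fst (f q) + - fst (f p))
                    * ((q - p) / ((q - p) * ((q - p) * 1) + 0 * (0 * 1)))
                    - (snd (f q) + - snd (f p))
                      * (- 0 / ((q - p) * ((q - p) * 1) + 0 * (0 * 1))));
          [exact B1 | field; nra].
      + replace ((snd (f q) - snd (f p)) / (q - p)) with
          ((fst (f q) + - fst (f p))
                    * (- 0 / ((q - p) * ((q - p) * 1) + 0 * (0 * 1)))
                    + (snd (f q) + - snd (f p))
                      * ((q - p) / ((q - p) * ((q - p) * 1) + 0 * (0 * 1))));
          [exact B2 | field; nra]. }
  assert (Cd : forall p, a <= p <= b -> forall e, 0 < e -> exists d, 0 < d /\
     forall q, a <= q <= b -> Rabs (q - p) < d ->
     Rabs (fst (df q) - fst (df p)) < e /\ Rabs (snd (df q) - snd (df p)) < e).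
  { intros p Hp e He. destruct (H p Hp) as [_ H2].
    destruct (H2 _ (locally_ball (df p) (mkposreal e He))) as [d Hd].
    exists d. split; [apply cond_pos | ]. intros q Hq Hqp.
    destruct (Hd q Hqp Hq) as [B1 B2]. split; [exact B1 | exact B2]. }
  destruct (C1_extension a b (fun q => fst (f q)) (fun q => fst (df q)) Hab)
    as [v1 [dv1 [D1 [C1 E1]]]].
  { intros p Hp e He. destruct (D p Hp e He) as [d [Hd K]].
    exists d. split; [exact Hd | ]. intros q Hq Hqp. apply (K q Hq Hqp). }
  { intros p Hp e He. destruct (Cd p Hp e He) as [d [Hd K]].
    exists d. split; [exact Hd | ]. intros q Hq Hqp. apply (K q Hq Hqp). }
  destruct (C1_extension a b (fun q => snd (f q)) (fun q => snd (df q)) Hab)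
    as [v2 [dv2 [D2 [C2 E2]]]].
  { intros p Hp e He. destruct (D p Hp e He) as [d [Hd K]].
    exists d. split; [exact Hd | ]. intros q Hq Hqp. apply (K q Hq Hqp). }
  { intros p Hp e He. destruct (Cd p Hp e He) as [d [Hd K]].
    exists d. split; [exact Hd | ]. intros q Hq Hqp. apply (K q Hq Hqp). }
  exists v1, dv1, v2, dv2. split; [auto | split; [auto | ]].
  intros x Hx. rewrite E1, E2 by exact Hx. apply surjective_pairing.
Qed.

Lemma is_RInt_gen_pair (f : R -> C) (Fa Fb : (R -> Prop) -> Prop)
    (FFa : Filter Fa) (FFb : Filter Fb) (l1 l2 : R) :
  is_RInt_gen (fun x => fst (f x)) Fa Fb l1 ->
  is_RInt_gen (fun x => snd (f x)) Fa Fb l2 ->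
  is_RInt_gen (V := C_R_NormedModule) f Fa Fb (l1, l2).
Proof.
  intros H1 H2. apply filterlimi_locally. intros e.
  assert (K1 : filter_prod Fa Fb (fun ab => exists z,
      is_RInt (fun x => fst (f x)) (fst ab) (snd ab) z /\ ball l1 e z))
    by exact (H1 _ (locally_ball l1 e)).
  assert (K2 : filter_prod Fa Fb (fun ab => exists z,
      is_RInt (fun x => snd (f x)) (fst ab) (snd ab) z /\ ball l2 e z))
    by exact (H2 _ (locally_ball l2 e)).
  assert (K := filter_and _ _ K1 K2).
  revert K. apply filter_imp. intros ab [[z1 [I1 B1]] [z2 [I2 B2]]].
  exists (z1, z2). split.
  - apply (is_RInt_fct_extend_pair (U := R_NormedModule) (V := R_NormedModule));
      assumption.
  - split; assumption.
Qed.

Lemma is_RInt_gen_shift (f : R -> R) (c L l : R) :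
  is_RInt_gen f (at_right 0) (at_left L) l ->
  is_RInt_gen (fun p => f (p - c)) (at_right c) (at_left (c + L)) l.
Proof.
  intros H P HP. destruct (H P HP) as [Q S HQ HS HQS].
  apply (Filter_prod _ _ _ (fun x => Q (x - c)) (fun y => S (y - c))).
  - destruct HQ as [d Hd]. exists d. intros x Hx Hxc. apply Hd.
    + change (Rabs (x - c - 0) < d). rewrite Rminus_0_r. exact Hx.
    + lra.
  - destruct HS as [d Hd]. exists d. intros x Hx Hxc. apply Hd.
    + change (Rabs (x - (c + L)) < d) in Hx.
      change (Rabs (x - c - L) < d).
      replace (x - c - L) with (x - (c + L)) by ring. exact Hx.
    + lra.
  - intros x y Hx Hy. destruct (HQS _ _ Hx Hy) as [z [Iz Pz]].
    simpl in Iz. exists z. split; [ | exact Pz]. simpl.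
    assert (K := is_RInt_comp_lin (V := R_NormedModule) f 1 (- c) x y z).
    replace (1 * x + - c) with (x - c) in K by ring.
    replace (1 * y + - c) with (y - c) in K by ring.
    apply (is_RInt_ext (V := R_NormedModule)) with (2 := K Iz).
    intros w _. unfold scal; simpl; unfold mult; simpl. as_R.
    rewrite Rmult_1_l. f_equal. ring.
Qed.

Lemma Cmod_le_sum (a b : R) : Cmod (a, b) <= Rabs a + Rabs b.
Proof.
  pose proof (Rabs_pos a). pose proof (Rabs_pos b).
  unfold Cmod. simpl fst. simpl snd.
  rewrite <- (sqrt_pow2 (Rabs a + Rabs b)) by lra.
  apply sqrt_le_1_alt. rewrite <- (pow2_abs a), <- (pow2_abs b). nra.
Qed.

Lemma Cmod_Cexpi (x : R) : Cmod (Cexpi x) = 1.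
Proof.
  unfold Cmod, Cexpi. simpl fst. simpl snd. rewrite <- sqrt_1. f_equal.
  pose proof (sin2_cos2 x). unfold Rsqr in *. simpl. lra.
Qed.

(** * The Schrodinger solution *)

(** Completing the square: for [x = 2 (p1 + s) t] and [q = p - p1] the phase is [- y] with
    [y = t (q - s)^2 - t (p1 + s)^2]. Since [e^(-i y) = cos y + i cos (y + PI / 2)], multiplication
    by [v1 + i v2] gives the two combinations of real integrals. *)
Lemma schrodinger_sol_eq (mu p1 p2 t s x l1 l1' l2 l2' : R)
    (Fu0 ut : R -> C) (v1 v2 : R -> R) :
  p1 < p2 -> x = 2 * (p1 + s) * t ->
  (forall p, p1 < p < p2 -> Fu0 p = (RtoC (Rpower (p - p1) (mu - 1)) * ut p)%C) ->
  (forall p, p1 <= p <= p2 -> ut p = (v1 (p - p1), v2 (p - p1))) ->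
  is_RInt_gen (osc_integrand mu v1 t s (- (t * (p1 + s) ^ 2)))
    (at_right 0) (at_left (p2 - p1)) l1 ->
  is_RInt_gen (osc_integrand mu v1 t s (- (t * (p1 + s) ^ 2) + PI / 2))
    (at_right 0) (at_left (p2 - p1)) l1' ->
  is_RInt_gen (osc_integrand mu v2 t s (- (t * (p1 + s) ^ 2)))
    (at_right 0) (at_left (p2 - p1)) l2 ->
  is_RInt_gen (osc_integrand mu v2 t s (- (t * (p1 + s) ^ 2) + PI / 2))
    (at_right 0) (at_left (p2 - p1)) l2' ->
  schrodinger_sol p1 p2 Fu0 t x
  = (RtoC (1 / (2 * PI)) * ((l1 - l2')%R, (l1' + l2)%R))%C.
Proof.
  intros Hp Hx HF Hut I1 I1' I2 I2'.
  set (th := - (t * (p1 + s) ^ 2)) in *.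
  assert (HR := is_RInt_gen_minus (V := R_NormedModule) _ _ _ _ I1 I2').
  assert (HI := is_RInt_gen_plus (V := R_NormedModule) _ _ _ _ I1' I2).
  apply (is_RInt_gen_shift _ p1) in HR. apply (is_RInt_gen_shift _ p1) in HI.
  replace (p1 + (p2 - p1)) with p2 in HR, HI by ring.
  unfold schrodinger_sol. f_equal.
  apply (is_RInt_gen_unique (V := C_R_CompleteNormedModule)).
  assert (Dom : filter_prod (at_right p1) (at_left p2)
                  (fun ab => p1 < fst ab < p2 /\ p1 < snd ab < p2)).
  { apply (Filter_prod _ _ _ (fun x => p1 < x < p2) (fun y => p1 < y < p2));
      [ | | simpl; auto].
    - assert (Hd : 0 < p2 - p1) by lra.
      exists (mkposreal _ Hd). intros y Hy Hy1.
      change (Rabs (y - p1) < p2 - p1) in Hy. apply Rabs_lt_between in Hy. lra.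
    - assert (Hd : 0 < p2 - p1) by lra.
      exists (mkposreal _ Hd). intros y Hy Hy1.
      change (Rabs (y - p2) < p2 - p1) in Hy. apply Rabs_lt_between in Hy. lra. }
  assert (Pt : forall p, p1 < p < p2 ->
     (Fu0 p * Cexpi (- (t * p ^ 2) + x * p))%C
     = (osc_integrand mu v1 t s th (p - p1)
        - osc_integrand mu v2 t s (th + PI / 2) (p - p1),
        osc_integrand mu v1 t s (th + PI / 2) (p - p1)
        + osc_integrand mu v2 t s th (p - p1))).
  { intros p Hpp. rewrite HF, Hut by lra. unfold osc_integrand.
    replace (t * (p - p1 - s) ^ 2 + (th + PI / 2))
      with (PI / 2 - (- (t * p ^ 2) + x * p)) by (unfold th; rewrite Hx; ring).
    replace (t * (p - p1 - s) ^ 2 + th)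
      with (- (- (t * p ^ 2) + x * p)) by (unfold th; rewrite Hx; ring).
    rewrite cos_neg, cos_shift.
    unfold Cexpi. apply injective_projections; simpl; ring. }
  apply is_RInt_gen_pair.
  - apply filter_filter.
  - apply filter_filter.
  - revert HR. apply is_RInt_gen_ext. revert Dom. apply filter_imp.
    intros [y z] [Hy Hz] p Hpp. simpl in *.
    assert (p1 < Rmin y z) by (apply Rmin_glb_lt; lra).
    assert (Rmax y z < p2) by (apply Rmax_lub_lt; lra).
    assert (E := Pt p ltac:(lra)). apply (f_equal fst) in E. symmetry. exact E.
  - revert HI. apply is_RInt_gen_ext. revert Dom. apply filter_imp.
    intros [y z] [Hy Hz] p Hpp. simpl in *.
    assert (p1 < Rmin y z) by (apply Rmin_glb_lt; lra).
    assert (Rmax y z < p2) by (apply Rmax_lub_lt; lra).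
    assert (E := Pt p ltac:(lra)). apply (f_equal snd) in E. symmetry. exact E.
Qed.

(** With [s = t^(-eps)] the factor [(2 t s)^(-mu)] splits into [2^(-mu)] and [t^(-mu + eps mu)]; the
    prefactor [1 / (2 PI)] completes the denominator [2^(mu+1) PI] of [Kcoef]. The rest is the angle
    addition of the phases. *)
Lemma leading_terms_eq (mu p1 eps t x : R) (ut : R -> C) (v1 v2 : R -> R) :
  let s := Rpower t (- eps) in
  let th := - (t * (p1 + s) ^ 2) in
  0 < t -> x = 2 * (p1 + s) * t ->
  ut p1 = (v1 0, v2 0) -> ut (p1 + s) = (v1 s, v2 s) ->
  (Hcoef p1 ut eps t * RtoC (Rpower t (- (1 / 2) + eps * (1 - mu)))
   + Kcoef p1 mu ut t x * RtoC (Rpower t (- mu + eps * mu)))%C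
  = (RtoC (1 / (2 * PI)) *
     ((osc_leading mu v1 t s th - osc_leading mu v2 t s (th + PI / 2))%R,
      (osc_leading mu v1 t s (th + PI / 2) + osc_leading mu v2 t s th)%R))%C.
Proof.
  intros s th Ht Hx U1 U2.
  assert (Hs : 0 < s) by apply Rpower_pos.
  unfold Hcoef, Kcoef. fold s. rewrite U1, U2.
  unfold osc_leading, Cexpi.
  replace (PI / 4 + (th + PI / 2)) with (PI / 2 - (- (PI / 4) - th)) by ring.
  replace (PI / 4 + th) with (- (- (PI / 4) - th)) by ring.
  replace (mu * PI / 2 + (- (t * s ^ 2) - (th + PI / 2)))
    with (- (PI / 2 - (PI * mu / 2 + (- (t * s ^ 2) - th)))) by field.
  replace (mu * PI / 2) with (PI * mu / 2) by field.
  replace (- (t * p1 ^ 2) + x * p1) with (- (t * s ^ 2) - th)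
    by (unfold th; rewrite Hx; ring).
  rewrite !cos_neg, !cos_shift.
  replace (t * (p1 + s) ^ 2) with (- th) by (unfold th; ring).
  set (k2 := - (t * s ^ 2) - th).
  replace (- (PI / 4) - th) with (- (PI / 4) + - th) by ring.
  rewrite (cos_plus (- (PI / 4))), (sin_plus (- (PI / 4))).
  rewrite (cos_plus (PI * mu / 2)), (sin_plus (PI * mu / 2)).
  rewrite ?(cos_neg (PI / 4)).
  set (c1 := cos (PI * mu / 2)). set (s1 := sin (PI * mu / 2)).
  set (ca := cos (PI / 4)). set (sa := sin (- (PI / 4))).
  set (cb := cos (- th)). set (sb := sin (- th)).
  assert (E1 : Rpower t (- (1 / 2) + eps * (1 - mu))
               = Rpower t (- (1 / 2)) * Rpower s (mu - 1)).
  { unfold s. rewrite Rpower_mult, <- Rpower_plus. f_equal. ring. }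
  assert (E2 : Rpower (2 * t * s) (- mu)
               = Rpower t (- mu + eps * mu) * / Rpower 2 mu).
  { rewrite <- !Rpower_mult_distr by lra. unfold s.
    rewrite Rpower_mult, (Rpower_plus (- mu)), (Rpower_Ropp 2).
    replace (- eps * - mu) with (eps * mu) by ring. ring. }
  rewrite E1, E2, Rpower_plus, Rpower_1 by lra.
  assert (P2 := Rpower_pos 2 mu).
  assert (Pp := PI_RGT_0).
  assert (Sp : sqrt PI * sqrt PI = PI) by (apply sqrt_sqrt; lra).
  assert (Sp0 : 0 < sqrt PI) by (apply sqrt_lt_R0; lra).
  (* Writing [PI] as [w * w] reconciles [sqrt PI / (2 PI)] with the prefactor [1 / (2 sqrt PI)] of
     [Hcoef]. *)
  set (w := sqrt PI) in *. rewrite <- Sp.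
  apply injective_projections; simpl; field; lra.
Qed.

(** The lower bound on [t] means that the stationary point [p1 + t^(-eps)] lies below [p2]. *)
Lemma on_curve_facts (p1 p2 eps t x : R) :
  p1 < p2 -> 0 < eps -> on_curve p1 p2 eps t x ->
  0 < t /\ Rpower t (- eps) < p2 - p1 /\ x = 2 * (p1 + Rpower t (- eps)) * t.
Proof.
  intros Hp He [Ht Hx].
  assert (Pt := Rpower_pos (p2 - p1) (- (1 / eps))).
  assert (T : 0 < t) by lra.
  split; [exact T | split].
  - assert (H : Rpower (Rpower (p2 - p1) (- (1 / eps))) eps < Rpower t eps)
      by (apply Rlt_Rpower_l; lra).
    rewrite Rpower_mult in H.
    replace (- (1 / eps) * eps) with (- (1)) in H by (field; lra).
    rewrite Rpower_Ropp, Rpower_1 in H by lra.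
    rewrite Rpower_Ropp, <- (Rinv_inv (p2 - p1)).
    assert (0 < / (p2 - p1)) by (apply Rinv_0_lt_compat; lra).
    apply Rinv_lt_contravar; [ | exact H].
    apply Rmult_lt_0_compat; lra.
  - replace x with (x / t * t) by (field; lra). rewrite Hx. ring.
Qed.

(** A single expansion serves all three regimes of [mu]. The bounds on [Hcoef] and [Kcoef] are
    recorded so that the dominated leading term can be moved into the error. *)
Lemma schrodinger_expansion (mu p1 p2 delta : R) (u0 : (R -> C) -> C)
    (Fu0 ut : R -> C) :
  0 < mu < 1 -> p1 < p2 -> condition_C p1 p2 mu u0 Fu0 ut ->
  1 / 2 < delta < 1 -> mu < delta ->
  exists A, 0 <= A /\
    forall eps t x, 0 < eps -> on_curve p1 p2 eps t x ->
    Cmod (Hcoef p1 ut eps t) <= A /\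
    Cmod (Kcoef p1 mu ut t x) <= A /\
    Cmod (schrodinger_sol p1 p2 Fu0 t x
          - (Hcoef p1 ut eps t * RtoC (Rpower t (- (1 / 2) + eps * (1 - mu)))
             + Kcoef p1 mu ut t x * RtoC (Rpower t (- mu + eps * mu))))%C
    <= A * Rpower t (- delta + eps * (2 - mu))
       + A * Rpower t (- delta + eps * (1 - mu)).
Proof.
  intros Hmu Hp [_ [HF [HC1 [_ Hut2]]]] Hd Hmd.
  destruct (C1_on_extension ut p1 p2 Hp HC1)
    as [w1 [dw1 [w2 [dw2 [[Dw1 Cw1] [[Dw2 Cw2] Ew]]]]]].
  set (L := p2 - p1).
  assert (HL : 0 < L) by (unfold L; lra).
  set (v1 := fun q => w1 (p1 + q)). set (v2 := fun q => w2 (p1 + q)).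
  assert (Sh : forall w dw : R -> R, (forall q, is_derive w q (dw q)) ->
            (forall q, continuous dw q) ->
            (forall q, is_derive (fun q => w (p1 + q)) q (dw (p1 + q))) /\
            (forall q, continuous (fun q => dw (p1 + q)) q)).
  { intros w dw Dw Cw. split; intros q.
    - replace (dw (p1 + q)) with (scal 1 (dw (p1 + q)))
        by (unfold scal; simpl; unfold mult; simpl; as_R; ring).
      apply (is_derive_comp w (fun q => p1 + q)); [apply Dw | ].
      auto_derive; [trivial | ring].
    - apply (continuous_comp (fun q => p1 + q) dw); [ | apply Cw].
      apply (ex_derive_continuous (V := R_NormedModule)). auto_derive. trivial. }
  destruct (Sh w1 dw1 Dw1 Cw1) as [Dv1 Cdv1].
  destruct (Sh w2 dw2 Dw2 Cw2) as [Dv2 Cdv2].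
  assert (Eut : forall p, p1 <= p <= p2 -> ut p = (v1 (p - p1), v2 (p - p1))).
  { intros p Hpp. unfold v1, v2. replace (p1 + (p - p1)) with p by ring.
    apply Ew, Hpp. }
  assert (E2 := Eut p2 ltac:(lra)). rewrite Hut2 in E2. fold L in E2.
  assert (Z1 : v1 L = 0) by (apply (f_equal fst) in E2; symmetry; exact E2).
  assert (Z2 : v2 L = 0) by (apply (f_equal snd) in E2; symmetry; exact E2).
  destruct (osc_integral_expansion mu delta L v1 _ Hmu Hd HL Dv1 Cdv1 Z1)
    as [C1 [C1p X1]].
  destruct (osc_integral_expansion mu delta L v2 _ Hmu Hd HL Dv2 Cdv2 Z2)
    as [C2 [C2p X2]].
  assert (Cv : forall (v dv : R -> R), (forall q, is_derive v q (dv q)) ->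
            forall q, continuous v q).
  { intros v dv Dv q. apply (ex_derive_continuous (V := R_NormedModule)).
    eexists. apply Dv. }
  destruct (continuous_bounded v1 0 L (Cv _ _ Dv1)) as [M1 [M1p B1]].
  destruct (continuous_bounded v2 0 L (Cv _ _ Dv2)) as [M2 [M2p B2]].
  assert (But : forall q, 0 <= q <= L -> Cmod (ut (p1 + q)) <= M1 + M2).
  { intros q Hq. rewrite Eut by (unfold L in Hq; lra).
    replace (p1 + q - p1) with q by ring.
    eapply Rle_trans; [apply Cmod_le_sum | ].
    apply Rplus_le_compat; auto. }
  assert (Pp := PI_RGT_0).
  set (h := 1 / (2 * sqrt PI)). set (g := Gamma mu / (Rpower 2 (mu + 1) * PI)).
  set (AH := Rabs h * (M1 + M2)). set (AK := Rabs g * (M1 + M2)).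
  assert (AHp : 0 <= AH) by (apply Rmult_le_pos; [apply Rabs_pos | lra]).
  assert (AKp : 0 <= AK) by (apply Rmult_le_pos; [apply Rabs_pos | lra]).
  set (r := 1 / (2 * PI)).
  assert (Hr : 0 < r) by (apply Rdiv_lt_0_compat; lra).
  set (A0 := r * (2 * C1 + 2 * C2)).
  assert (A0p : 0 <= A0) by (apply Rmult_le_pos; lra).
  assert (PL := Rpower_pos L (1 - mu)).
  (* [A0] is the error constant for [t >= 1] and bounds the solution at all times. The factor
     [L^(1-mu)] is the price of comparing a constant with [s^(mu-1)] when [t < 1]. *)
  set (A := (A0 + AK) * Rpower L (1 - mu) + A0 + AH + AK).
  assert (Q : 0 <= (A0 + AK) * Rpower L (1 - mu)) by (apply Rmult_le_pos; lra).
  exists A. split; [unfold A; lra | ].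
  intros eps t x He Hon.
  destruct (on_curve_facts p1 p2 eps t x Hp He Hon) as [Ht [Hs Hx]].
  set (s := Rpower t (- eps)) in *. fold L in Hs.
  assert (Hs0 : 0 < s) by apply Rpower_pos.
  assert (BH : Cmod (Hcoef p1 ut eps t) <= AH).
  { unfold Hcoef. fold s h. rewrite !Cmod_mult, !Cmod_Cexpi, Cmod_R.
    rewrite !Rmult_1_r. apply Rmult_le_compat_l; [apply Rabs_pos | ].
    apply But. lra. }
  assert (BK : Cmod (Kcoef p1 mu ut t x) <= AK).
  { unfold Kcoef. fold g. rewrite !Cmod_mult, !Cmod_Cexpi, Cmod_R.
    rewrite !Rmult_1_r. apply Rmult_le_compat_l; [apply Rabs_pos | ].
    rewrite <- (Rplus_0_r p1) at 1. apply But. lra. }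
  split; [unfold A; lra | split; [unfold A; lra | ]].
  set (th := - (t * (p1 + s) ^ 2)).
  destruct (X1 t s th) as [l1 [I1 [T1 N1]]].
  destruct (X1 t s (th + PI / 2)) as [l1' [I1' [T1' N1']]].
  destruct (X2 t s th) as [l2 [I2 [T2 N2]]].
  destruct (X2 t s (th + PI / 2)) as [l2' [I2' [T2' N2']]].
  assert (U := schrodinger_sol_eq mu p1 p2 t s x l1 l1' l2 l2' Fu0 ut v1 v2
                 Hp Hx HF Eut I1 I1' I2 I2').
  fold r in U.
  set (e8 := Rpower t (- delta + eps * (2 - mu))).
  set (e9 := Rpower t (- delta + eps * (1 - mu))).
  assert (P8 : 0 < e8) by apply Rpower_pos.
  assert (P9 : 0 < e9) by apply Rpower_pos.
  destruct (Rle_lt_dec 1 t) as [Ht1|Ht1].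
  - assert (Hs1 : s <= 1).
    { rewrite <- (Rpower_base_1 (- eps)). apply Rpower_le_antitone; lra. }
    assert (Ee : Rpower s (mu - 2) * Rpower t (- delta) = e8).
    { unfold s, e8. rewrite Rpower_mult, <- Rpower_plus. f_equal. ring. }
    specialize (N1 Ht1 (conj Hs0 Hs1) Hs). specialize (N1' Ht1 (conj Hs0 Hs1) Hs).
    specialize (N2 Ht1 (conj Hs0 Hs1) Hs). specialize (N2' Ht1 (conj Hs0 Hs1) Hs).
    rewrite Ee in N1, N1', N2, N2'.
    assert (LT := leading_terms_eq mu p1 eps t x ut v1 v2 Ht Hx).
    fold s th r in LT.
    rewrite LT, U.
    2: { rewrite Eut by lra. rewrite Rminus_diag. reflexivity. }
    2: { unfold L in Hs. rewrite Eut by lra. f_equal; f_equal; ring. }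
    set (a1 := osc_leading mu v1 t s th) in *.
    set (a1' := osc_leading mu v1 t s (th + PI / 2)) in *.
    set (a2 := osc_leading mu v2 t s th) in *.
    set (a2' := osc_leading mu v2 t s (th + PI / 2)) in *.
    replace (RtoC r * ((l1 - l2')%R, (l1' + l2)%R)
             - RtoC r * ((a1 - a2')%R, (a1' + a2)%R))%C
      with (RtoC r * (((l1 - a1) - (l2' - a2'))%R, ((l1' - a1') + (l2 - a2))%R))%C
      by (apply injective_projections; simpl; ring).
    rewrite Cmod_mult, Cmod_R, (Rabs_pos_eq r) by lra.
    assert (K : Cmod ((l1 - a1) - (l2' - a2'), (l1' - a1') + (l2 - a2))
                <= (2 * C1 + 2 * C2) * e8).
    { eapply Rle_trans; [apply Cmod_le_sum | ].
      pose proof (Rabs_triang (l1 - a1) (- (l2' - a2'))) as R1.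
      rewrite Rabs_Ropp in R1.
      pose proof (Rabs_triang (l1' - a1') (l2 - a2)) as R2.
      unfold Rminus at 1. lra. }
    apply Rle_trans with (A0 * e8).
    + unfold A0. rewrite Rmult_assoc. apply Rmult_le_compat_l; lra.
    + assert (A0 * e8 <= A * e8)
        by (apply Rmult_le_compat_r; [lra | unfold A; lra]).
      assert (0 <= A * e9) by (apply Rmult_le_pos; [unfold A | ]; lra).
      lra.
  (* For [t < 1] no cancellation is used: the solution and the two leading terms are each bounded by
     a multiple of [e9]. *)
  - assert (BU : Cmod (schrodinger_sol p1 p2 Fu0 t x) <= A0).
    { rewrite U, Cmod_mult, Cmod_R, (Rabs_pos_eq r) by lra.
      unfold A0. apply Rmult_le_compat_l; [lra | ].
      eapply Rle_trans; [apply Cmod_le_sum | ].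
      pose proof (Rabs_triang l1 (- l2')) as R1. rewrite Rabs_Ropp in R1.
      pose proof (Rabs_triang l1' l2). unfold Rminus. lra. }
    assert (Es : e9 = Rpower t (- delta) * Rpower s (mu - 1)).
    { unfold s, e9. rewrite Rpower_mult, <- Rpower_plus. f_equal. ring. }
    assert (S1 : 1 <= Rpower L (1 - mu) * Rpower s (mu - 1)).
    { replace (mu - 1) with (- (1 - mu)) by ring. rewrite Rpower_Ropp.
      assert (Q1 := Rpower_pos s (1 - mu)).
      apply (Rmult_le_reg_r (Rpower s (1 - mu))); [exact Q1 | ].
      rewrite Rmult_assoc, Rinv_l, Rmult_1_l, Rmult_1_r by lra.
      apply Rle_Rpower_l; lra. }
    assert (Ptd : 1 <= Rpower t (- delta)).
    { rewrite <- (Rpower_O t) at 1 by exact Ht. apply Rpower_le_exponent; lra. }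
    assert (Q2 := Rpower_pos s (mu - 1)).
    assert (S2 : Rpower t (- delta) <= Rpower L (1 - mu) * e9).
    { rewrite Es.
      replace (Rpower L (1 - mu) * (Rpower t (- delta) * Rpower s (mu - 1)))
        with (Rpower t (- delta) * (Rpower L (1 - mu) * Rpower s (mu - 1))) by ring.
      rewrite <- (Rmult_1_r (Rpower t (- delta))) at 1.
      apply Rmult_le_compat_l; lra. }
    assert (SH : Rpower t (- (1 / 2) + eps * (1 - mu)) <= e9)
      by (apply Rpower_le_exponent; lra).
    (* [mu < delta] enters here: below time 1 the smaller exponent gives the larger power. *)
    assert (SK : Rpower t (- mu + eps * mu) <= Rpower t (- delta)).
    { apply Rpower_le_exponent; [lra | ].
      assert (0 < eps * mu) by (apply Rmult_lt_0_compat; lra). lra. }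
    set (H := Hcoef p1 ut eps t) in *. set (K := Kcoef p1 mu ut t x) in *.
    set (u := schrodinger_sol p1 p2 Fu0 t x) in *.
    assert (PH := Rpower_pos t (- (1 / 2) + eps * (1 - mu))).
    assert (PK := Rpower_pos t (- mu + eps * mu)).
    set (yH := Rpower t (- (1 / 2) + eps * (1 - mu))) in *.
    set (yK := Rpower t (- mu + eps * mu)) in *.
    unfold Cminus. eapply Rle_trans; [apply Cmod_triangle | ].
    rewrite Cmod_opp.
    eapply Rle_trans; [apply Rplus_le_compat_l, Cmod_triangle | ].
    rewrite !Cmod_mult, !Cmod_R, (Rabs_pos_eq yH), (Rabs_pos_eq yK) by lra.
    assert (G1 : Cmod H * yH <= AH * e9)
      by (apply Rmult_le_compat; try lra; apply Cmod_ge_0).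
    assert (G2 : Cmod K * yK <= AK * (Rpower L (1 - mu) * e9))
      by (apply Rmult_le_compat; try lra; apply Cmod_ge_0).
    assert (G3 : A0 <= A0 * (Rpower L (1 - mu) * e9)).
    { rewrite <- (Rmult_1_r A0) at 1. apply Rmult_le_compat_l; lra. }
    assert (0 <= A * e8) by (apply Rmult_le_pos; [unfold A | ]; lra).
    assert (0 <= (A0 + AK) * e9) by (apply Rmult_le_pos; lra).
    unfold A at 2. lra.
Qed.

Lemma MaxRlist_lt (l : list R) (b : R) :
  l <> nil -> List.Forall (fun x => x < b) l -> MaxRlist l < b.
Proof.
  intros Hl H. induction H as [|x l Hx H IH]; [easy | ].
  destruct l as [|y l]; [exact Hx | ].
  change (Rmax x (MaxRlist (y :: l)) < b).
  apply Rmax_lub_lt; [exact Hx | apply IH; discriminate].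
Qed.

Lemma error_sum_ge_term (n k : nat) (A : R) (alpha beta : nat -> R) (eps t : R) :
  0 <= A -> (1 <= k <= n)%nat ->
  A * Rpower t (expo alpha beta eps k)
  <= error_sum n (fun _ => A) alpha beta eps t.
Proof.
  intros HA.
  set (f := fun k => A * Rpower t (expo alpha beta eps k)).
  assert (Pf : forall k, 0 <= f k)
    by (intros; apply Rmult_le_pos; [exact HA | left; apply Rpower_pos]).
  change ((1 <= k <= n)%nat -> f k <= sum_n_m f 1 n).
  assert (S : forall n, sum_n_m f 1 (S n) = sum_n_m f 1 n + f (S n))
    by (intros m; apply (sum_n_Sm (G := R_AbelianMonoid)); lia).
  assert (P : forall n, 0 <= sum_n_m f 1 n).
  { intros m. induction m as [|m IH].
    - rewrite sum_n_m_zero by lia. apply Rle_refl.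
    - rewrite S. specialize (Pf (Datatypes.S m)). lra. }
  induction n as [|n IH]; intros Hk; [lia | ].
  rewrite S. destruct (Nat.eq_dec k (Datatypes.S n)) as [->|N].
  - specialize (P n). lra.
  - specialize (IH ltac:(lia)). specialize (Pf (Datatypes.S n)). lra.
Qed.

Theorem theorem4p8 (mu p1 p2 delta : R) (u0 : (R -> C) -> C) (Fu0 ut : R -> C) :
  0 < mu < 1 -> p1 < p2 ->
  tempered u0 -> condition_C p1 p2 mu u0 Fu0 ut ->
  1 / 2 < delta < 1 -> mu < delta ->
  let gamma := 2 * delta - 1 in
  exists C1 C2 C3 : nat -> R,
    (forall k, 0 <= C1 k) /\ (forall k, 0 <= C2 k) /\ (forall k, 0 <= C3 k) /\
    forall eps : R, 0 < eps < 1 / 2 -> 1 / 2 + eps < delta ->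
    (1 / 2 < mu ->
      (forall t x : R, on_curve p1 p2 eps t x ->
        Cmod (schrodinger_sol p1 p2 Fu0 t x
              - Hcoef p1 ut eps t
                * RtoC (Rpower t (- (1 / 2) + eps * (1 - mu))))%C
        <= error_sum 9 C1 (alpha1 mu gamma) (beta1 mu delta) eps t) /\
      max_expo 9 (alpha1 mu gamma) (beta1 mu delta) eps
        < - (1 / 2) + eps * (1 - mu)) /\
    (mu = 1 / 2 ->
      (forall t x : R, on_curve p1 p2 eps t x ->
        Cmod (schrodinger_sol p1 p2 Fu0 t x
              - (Kcoef p1 mu ut t x + Hcoef p1 ut eps t)
                * RtoC (Rpower t (- (1 / 2) + eps / 2)))%C
        <= error_sum 8 C2 (alpha2 mu gamma) (beta2 delta) eps t) /\
      max_expo 8 (alpha2 mu gamma) (beta2 delta) eps < - (1 / 2) + eps / 2) /\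
    (mu < 1 / 2 ->
      (forall t x : R, on_curve p1 p2 eps t x ->
        Cmod (schrodinger_sol p1 p2 Fu0 t x
              - Kcoef p1 mu ut t x * RtoC (Rpower t (- mu + eps * mu)))%C
        <= error_sum 9 C3 (alpha3 mu gamma) (beta3 delta) eps t) /\
      max_expo 9 (alpha3 mu gamma) (beta3 delta) eps < - mu + eps * mu).
Proof.
  intros Hmu Hp _ HC Hd Hmd gamma.
  destruct (schrodinger_expansion mu p1 p2 delta u0 Fu0 ut Hmu Hp HC Hd Hmd)
    as [A [HA X]].
  (* At most three terms of the sum carry the estimate. Each is compared separately with the whole
     sum, which costs the factor [3]. *)
  assert (HA3 : 0 <= 3 * A) by lra.
  exists (fun _ => 3 * A), (fun _ => 3 * A), (fun _ => 3 * A).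
  do 3 (split; [intros _; exact HA3 | ]).
  intros eps He Hde.
  assert (Hem : 0 < eps * mu) by (apply Rmult_lt_0_compat; lra).
  (* This is [eps < 1/2] multiplied by [2 delta - 1]; it settles the exponents that contain [gamma].
     The exponent [-delta + eps(2-mu)] is settled by [Hde]. *)
  assert (Hed : eps * (2 * delta - 1) < delta - 1 / 2) by nra.
  split; [ | split].
  - intros Hmu2. split.
    + intros t x Hon.
      destruct (X eps t x (proj1 He) Hon) as [_ [BK B]].
      set (al := alpha1 mu gamma). set (be := beta1 mu delta).
      assert (E1 := error_sum_ge_term 9 1 (3 * A) al be eps t HA3 ltac:(lia)).
      assert (E8 := error_sum_ge_term 9 8 (3 * A) al be eps t HA3 ltac:(lia)).
      assert (E9 := error_sum_ge_term 9 9 (3 * A) al be eps t HA3 ltac:(lia)).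
      change (expo al be eps 1) with (- mu + eps * mu) in E1.
      change (expo al be eps 8) with (- delta + eps * (2 - mu)) in E8.
      change (expo al be eps 9) with (- delta + eps * (1 - mu)) in E9.
      (* For [mu > 1/2] the [Kcoef] term is the smaller one and is charged to the first term of the
         sum. *)
      match type of B with Cmod (?u - (?h + ?k))%C <= _ =>
        replace (u - h)%C with ((u - (h + k)) + k)%C by ring end.
      eapply Rle_trans; [apply Cmod_triangle | ].
      rewrite Cmod_mult, Cmod_R, (Rabs_pos_eq (Rpower _ _))
        by (left; apply Rpower_pos).
      pose proof (Rpower_pos t (- mu + eps * mu)).
      assert (Cmod (Kcoef p1 mu ut t x) * Rpower t (- mu + eps * mu)
              <= A * Rpower t (- mu + eps * mu))
        by (apply Rmult_le_compat_r; lra).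
      lra.
    + apply MaxRlist_lt; [discriminate | ].
      (* Half of the gap between the two leading exponents, [-1/2 + eps(1-mu)] and
         [-mu + eps mu]. *)
      assert (0 < (mu - 1 / 2) * (1 / 2 - eps)) by (apply Rmult_lt_0_compat; lra).
      repeat constructor; unfold expo, alpha1, beta1, gamma; simpl; lra.
  - intros Hmu2. split.
    + intros t x Hon.
      destruct (X eps t x (proj1 He) Hon) as [_ [_ B]].
      set (al := alpha2 mu gamma). set (be := beta2 delta).
      assert (E7 := error_sum_ge_term 8 7 (3 * A) al be eps t HA3 ltac:(lia)).
      assert (E8 := error_sum_ge_term 8 8 (3 * A) al be eps t HA3 ltac:(lia)).
      change (expo al be eps 7) with (- delta + eps * (2 - mu)) in E7.
      change (expo al be eps 8) with (- delta + eps * (1 - mu)) in E8.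
      (* At [mu = 1/2] the two leading powers coincide, so both coefficients stay in the leading
         term. *)
      replace (- (1 / 2) + eps * (1 - mu)) with (- (1 / 2) + eps / 2) in B
        by (rewrite Hmu2; field).
      replace (- mu + eps * mu) with (- (1 / 2) + eps / 2) in B
        by (rewrite Hmu2; field).
      match type of B with Cmod (?u - (?h * ?c + ?k * ?c))%C <= _ =>
        replace (u - (k + h) * c)%C with (u - (h * c + k * c))%C by ring end.
      pose proof (Rpower_pos t (- delta + eps * (2 - mu))).
      assert (0 <= A * Rpower t (- delta + eps * (2 - mu)))
        by (apply Rmult_le_pos; lra).
      lra.
    + apply MaxRlist_lt; [discriminate | ].
      repeat constructor; unfold expo, alpha2, beta2, gamma; simpl;
        rewrite Hmu2; lra.
  - intros Hmu2. split.
    + intros t x Hon.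
      destruct (X eps t x (proj1 He) Hon) as [BH [_ B]].
      set (al := alpha3 mu gamma). set (be := beta3 delta).
      assert (E1 := error_sum_ge_term 9 1 (3 * A) al be eps t HA3 ltac:(lia)).
      assert (E8 := error_sum_ge_term 9 8 (3 * A) al be eps t HA3 ltac:(lia)).
      assert (E9 := error_sum_ge_term 9 9 (3 * A) al be eps t HA3 ltac:(lia)).
      change (expo al be eps 1) with (- (1 / 2) + eps * (1 - mu)) in E1.
      change (expo al be eps 8) with (- delta + eps * (2 - mu)) in E8.
      change (expo al be eps 9) with (- delta + eps * (1 - mu)) in E9.
      (* The roles are exchanged for [mu < 1/2]: the [Hcoef] term is charged to the first term of
         the sum. *)
      match type of B with Cmod (?u - (?h + ?k))%C <= _ =>
        replace (u - k)%C with ((u - (h + k)) + h)%C by ring end.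
      eapply Rle_trans; [apply Cmod_triangle | ].
      rewrite Cmod_mult, Cmod_R, (Rabs_pos_eq (Rpower _ _))
        by (left; apply Rpower_pos).
      pose proof (Rpower_pos t (- (1 / 2) + eps * (1 - mu))).
      assert (Cmod (Hcoef p1 ut eps t) * Rpower t (- (1 / 2) + eps * (1 - mu))
              <= A * Rpower t (- (1 / 2) + eps * (1 - mu)))
        by (apply Rmult_le_compat_r; lra).
      lra.
    + apply MaxRlist_lt; [discriminate | ].
      (* Again half of the gap between the leading exponents, which now has the opposite sign. The
         remaining exponents lie below [-1/2 + eps(1-mu)], hence below [-mu + eps mu]. *)
      assert (0 < (1 / 2 - mu) * (1 / 2 - eps)) by (apply Rmult_lt_0_compat; lra).
      repeat constructor; unfold expo, alpha3, beta3, gamma; simpl; lra.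
Qed.
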